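(* For all odd integers $k\geq 3$, all zeros $z$ of $E_k$ in $\overline{\mathcal F}$ satisfy $$1<|z|<4^{1/k}.$$
   Context: Let $\mathfrak{H}$ be the complex upper half plane and $q=e^{2\pi i\tau}$. For odd $k\ge3$, $$E_k(\tau)=1+c_k\sum_{n\ge1}\sigma_{k-1}(n)q^n,\qquad c_k=\frac{(-2\pi i)^k}{\zeta(k)(k-1)!},\quad \sigma_{k-1}(n)=\sum_{d\mid n}d^{k-1};$$ equivalently $E_k(\tau)=\sum (m\tau+n)^{-k}$ over coprime integers $(m,n)$ with $m>0$, or $m=0$ and $n>0$. The closed fundamental domain is $\overline{\mathcal F}=\{z\in\mathfrak{H}: |z|\ge1,\ -\frac12\le \mathrm{Re}(z)\le\frac12\}\cup\{i\infty\}$. ($E_k$ takes the value $1$ at $i\infty$, so $i\infty$ is not a zero.) *)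

(* Defs.v *)
From Stdlib Require Import Reals List Arith.
From Coquelicot Require Import Coquelicot.
Open Scope R_scope.

Definition Cexp (z : C) : C :=
  (exp (Re z) * cos (Im z), exp (Re z) * sin (Im z)).

(* Junk value when [a] is not summable, in the same way as [RInt]. *)
Definition CSeries (a : nat -> C) : C :=
  iota (T := C_CompleteNormedModule)
    (fun l => is_series (V := C_CompleteNormedModule) a l).

Definition zeta (k : nat) : R := Series (fun n => / INR (S n) ^ k).

Definition sigma_div (j n : nat) : nat :=
  list_sum (map (fun d => Nat.pow d j)
                (filter (fun d => Nat.eqb (n mod d) 0) (seq 1 n))).

Definition nome (tau : C) : C := Cexp (2 * PI * Ci * tau)%C.

Definition eis_coef (k : nat) : C :=
  ((- (2 * PI * Ci)) ^ k / (zeta k * INR (fact (k - 1))))%C.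

(* The term of index [n] is the coefficient of [q ^ (n + 1)]. *)
Definition eisenstein (k : nat) (tau : C) : C :=
  (1 + eis_coef k *
       CSeries (fun n => INR (sigma_div (k - 1) (S n)) * nome tau ^ (S n)))%C.

(* Complex numbers together with the cusp [i oo]. *)
Inductive cplx_cusp : Set :=
  | Pt (z : C)
  | Cusp.

Definition eisenstein_cusp (k : nat) (z : cplx_cusp) : C :=
  match z with
  | Pt tau => eisenstein k tau
  | Cusp => 1
  end.

Definition Cmod_cusp (z : cplx_cusp) : Rbar :=
  match z with
  | Pt tau => Finite (Cmod tau)
  | Cusp => p_infty
  end.

Definition fund_domain (z : cplx_cusp) : Prop :=
  match z with
  | Pt tau => 0 < Im tau /\ 1 <= Cmod tau /\ - (1 / 2) <= Re tau <= 1 / 2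
  | Cusp => True
  end.

(* Main.v *)
Require Import Defs.
From Stdlib Require Import Reals List Arith.
From Coquelicot Require Import Coquelicot.
From Stdlib Require Import Lra Lia FunctionalExtensionality.
Open Scope R_scope.

(** Zeta-scaling turns [E_k] into the full lattice sum
    [zeta k + zeta k / z^k + P + N], where [P] and [N] are the sums of
    [(m z + n)^-k] over [m > 0] and [n > 0], resp. [n < 0].  If [|z| = 1] then
    conjugation is [z -> 1/z], so that [conj P = z^k P] and, [k] being odd,
    [conj N = - z^k N]; hence a zero on the unit circle forces [N = 0].  But the
    term [(z - 1)^-k] dominates the rest of [N] since
    [|m z - n|^2 >= m n |z - 1|^2].  If [|z|^k >= 4], then [|P| + |N|] is smaller than
    [3/4], by [|m z + n|^2 >= c m n] with [c = 2|z|] or [c = 2|z| - 1] according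
    to the sign of [n Re z].  Both estimates only involve the square of
    [sum_m m^(-k/2)] and hold for [k >= 5]; for [k = 3] the q-series itself is
    dominated by its constant term.

    The passage from the q-series to the lattice is Lipschitz' formula, the limit
    for [N -> oo] of the identity
    [sum_(j mod N) (N (1 - e((tau + j)/N)))^-k = sum_l N^(1-k) binom(l N + k - 1, k - 1) q^l],
    itself the binomial series filtered by the N-th roots of unity. *)

(** * Complex series *)

(** By the arithmetic-geometric mean inequality every lattice vector [w = m z + n] satisfies
    [|w|^2 >= c |m n|], so [|w|^-k] has a majorant that is a product of a function of [m] and one of
    [n]. Such a majorant both justifies the exchanges of summation and makes a single number
    [A = sum_m m^(-k/2)] control the lattice sums. On the unit circle the term [(z - 1)^-k]
    dominates as soon as [A^2 - 1 < 1]. At [k = 5] one has [A < 1.384], just enough; at [k = 3], [A]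
    is about [2.61], and the method fails.

    The relations for [conj P] and [conj N] come from transposing [(m, n)]: if [z conj z = 1] and
    [e = 1] or [e = -1], then [m conj z + e n = e conj z (n z + e m)].

    In Lipschitz' formula both sides of the finite identity pass to the limit by dominated
    convergence. This is why [N = 2 M + 1] is odd and the residues [j] are centred at [0]: each
    integer then owns one term from some [N] on, and all angles stay away from a full turn, which
    gives a majorant independent of [N]. *)

Fixpoint csum (a : nat -> C) (n : nat) : C :=
  match n with
  | O => 0
  | S p => (csum a p + a p)%C
  end.

Fixpoint rsum (a : nat -> R) (n : nat) : R :=
  match n with
  | O => 0
  | S p => rsum a p + a p
  end.

(** Stated through a real sequence of moduli, so that the calculus of real limits applies directly;
    [is_series_csum] makes the link with the series behind [CSeries]. *)
Definition Clim (u : nat -> C) (l : C) : Prop :=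
  is_lim_seq (fun n => Cmod (u n - l)) 0.

(** As [CSeries] has a junk value on divergent series, its algebraic rules carry this absolute
    convergence as a side condition. *)
Definition asum (a : nat -> C) : Prop := ex_series (fun n => Cmod (a n)).

Lemma Clim_le (u : nat -> C) (l : C) (e : nat -> R) :
  (forall n, Cmod (u n - l) <= e n) -> is_lim_seq e 0 -> Clim u l.
Proof.
  intros H He. apply is_lim_seq_le_le with (fun _ => 0) e.
  - intros n. split. apply Cmod_ge_0. apply H.
  - apply is_lim_seq_const.
  - exact He.
Qed.

Lemma Clim_unique (u : nat -> C) (l l' : C) : Clim u l -> Clim u l' -> l = l'.
Proof.
  intros H H'.
  assert (H0 : Cmod (l - l') = 0).
  { apply Rle_antisym; [|apply Cmod_ge_0].
    assert (Hs := is_lim_seq_plus' _ _ _ _ H H'). rewrite Rplus_0_r in Hs.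
    refine (is_lim_seq_le (fun _ => Cmod (l - l')) _ (Finite _) (Finite _) _ (is_lim_seq_const _) Hs).
    intros n. rewrite <- (Cmod_opp (u n - l)).
    eapply Rle_trans; [|apply Cmod_triangle]. apply Req_le. f_equal. ring. }
  apply Cmod_eq_0 in H0.
  replace l with ((l - l') + l')%C by ring. rewrite H0. ring.
Qed.

Lemma Clim_ext (u v : nat -> C) (l : C) :
  (forall n, u n = v n) -> Clim u l -> Clim v l.
Proof.
  intros E. apply is_lim_seq_ext. intros n. now rewrite E.
Qed.

Lemma Clim_const (c : C) : Clim (fun _ => c) c.
Proof.
  apply Clim_le with (fun _ => 0); [|apply is_lim_seq_const].
  intros n. replace (c - c)%C with (RtoC 0) by ring. rewrite Cmod_0. lra.
Qed.

Lemma Clim_plus (u v : nat -> C) (l m : C) :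
  Clim u l -> Clim v m -> Clim (fun n => u n + v n)%C (l + m)%C.
Proof.
  intros Hu Hv. apply Clim_le with (fun n => Cmod (u n - l) + Cmod (v n - m)).
  - intros n. eapply Rle_trans; [|apply Cmod_triangle]. apply Req_le. f_equal. ring.
  - rewrite <- (Rplus_0_r 0). now apply is_lim_seq_plus'.
Qed.

Lemma Clim_mult (u v : nat -> C) (l m : C) :
  Clim u l -> Clim v m -> Clim (fun n => u n * v n)%C (l * m)%C.
Proof.
  intros Hu Hv.
  apply Clim_le with (fun n => Cmod (u n - l) * Cmod (v n - m)
    + (Cmod (u n - l) * Cmod m + Cmod l * Cmod (v n - m))).
  - intros n. rewrite <- !Cmod_mult.
    eapply Rle_trans; [|apply Rplus_le_compat_l, Cmod_triangle].
    eapply Rle_trans; [|apply Cmod_triangle]. apply Req_le. f_equal. ring.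
  - replace (Finite 0) with (Finite (0 * 0 + (0 * Cmod m + Cmod l * 0))) by (f_equal; ring).
    apply is_lim_seq_plus'; [now apply is_lim_seq_mult'|].
    apply is_lim_seq_plus'; apply is_lim_seq_mult'; trivial; apply is_lim_seq_const.
Qed.

Lemma Clim_pow (u : nat -> C) (l : C) (k : nat) :
  Clim u l -> Clim (fun n => u n ^ k)%C (l ^ k)%C.
Proof.
  intros Hu. induction k as [|k IH].
  - apply (Clim_const 1).
  - now apply (Clim_mult u).
Qed.

Lemma Clim_Cmod (u : nat -> C) (l : C) :
  Clim u l -> is_lim_seq (fun n => Cmod (u n)) (Cmod l).
Proof.
  intros H.
  assert (H1 := is_lim_seq_minus' _ _ _ _ (is_lim_seq_const (Cmod l)) H).
  assert (H2 := is_lim_seq_plus' _ _ _ _ (is_lim_seq_const (Cmod l)) H).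
  rewrite Rminus_0_r in H1. rewrite Rplus_0_r in H2.
  refine (is_lim_seq_le_le _ _ _ _ _ H1 H2). intros n.
  assert (A := Cmod_triangle (u n) (- (u n - l))).
  assert (B := Cmod_triangle l (u n - l)).
  rewrite Cmod_opp in A.
  replace (u n + - (u n - l))%C with l in A by ring.
  replace (l + (u n - l))%C with (u n) in B by ring. lra.
Qed.

Lemma Clim_inv (u : nat -> C) (l : C) :
  l <> 0 -> (forall n, u n <> 0) -> Clim u l -> Clim (fun n => / u n)%C (/ l)%C.
Proof.
  intros Hl Hn Hu.
  apply Clim_le with (fun n => Cmod (u n - l) * / (Cmod (u n) * Cmod l)).
  - intros n. rewrite <- Cmod_mult, <- Cmod_inv, <- Cmod_mult
      by auto using Cmult_neq_0.
    rewrite <- Cmod_opp. apply Req_le. f_equal. field. auto.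
  - replace (Finite 0) with (Finite (0 * / (Cmod l * Cmod l))) by (f_equal; ring).
    apply is_lim_seq_mult'; [exact Hu|].
    apply Cmod_gt_0 in Hl.
    refine (is_lim_seq_inv _ (Finite (Cmod l * Cmod l)) _ _).
    + apply is_lim_seq_mult'; [now apply Clim_Cmod|apply is_lim_seq_const].
    + intros E. injection E. nra.
Qed.

Lemma Clim_subseq (u : nat -> C) (l : C) (phi : nat -> nat) :
  filterlim phi eventually eventually -> Clim u l -> Clim (fun n => u (phi n)) l.
Proof.
  intros Hphi Hu. exact (is_lim_seq_subseq _ _ _ Hphi Hu).
Qed.

Lemma csum_sum_n (a : nat -> C) (n : nat) :
  csum a (S n) = sum_n (G := C_CompleteNormedModule) a n.
Proof.
  induction n as [|n IH].
  - rewrite sum_O. simpl. ring.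
  - rewrite sum_Sn, <- IH. reflexivity.
Qed.

Lemma rsum_sum_n (a : nat -> R) (n : nat) : rsum a (S n) = sum_n a n.
Proof.
  induction n as [|n IH].
  - rewrite sum_O. simpl. ring.
  - rewrite sum_Sn, <- IH. reflexivity.
Qed.

Lemma is_series_csum (a : nat -> C) (l : C) :
  is_series (V := C_CompleteNormedModule) a l <-> Clim (csum a) l.
Proof.
  split; intros H.
  - unfold Clim. apply is_lim_seq_incr_1.
    apply is_lim_seq_spec. intros eps.
    assert (H' : locally (T := C_CompleteNormedModule) l
       (fun y => ball_norm (V := C_CompleteNormedModule) l eps y)).
    { apply (locally_le_locally_norm (V := C_CompleteNormedModule)), locally_norm_ball_norm. }
    apply H in H'. destruct H' as [N HN]. exists N. intros n Hn.
    specialize (HN n Hn). rewrite <- csum_sum_n in HN.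
    rewrite Rminus_0_r, Rabs_pos_eq by apply Cmod_ge_0. exact HN.
  - intros P HP.
    apply (locally_norm_le_locally (V := C_CompleteNormedModule)) in HP.
    destruct HP as [eps HP].
    apply is_lim_seq_incr_1 in H. apply is_lim_seq_spec in H.
    destruct (H eps) as [N HN]. exists N. intros n Hn.
    apply HP. specialize (HN n Hn). simpl in HN.
    rewrite Rminus_0_r, Rabs_pos_eq in HN by apply Cmod_ge_0.
    rewrite <- csum_sum_n. exact HN.
Qed.

Lemma CSeries_unique (a : nat -> C) (l : C) : Clim (csum a) l -> CSeries a = l.
Proof.
  intros H. unfold CSeries. apply (iota_unique (V := C_CompleteNormedModule)).
  - intros y Hy. apply is_series_csum in Hy. exact (Clim_unique _ _ _ Hy H).
  - now apply is_series_csum.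
Qed.

Lemma CSeries_correct (a : nat -> C) : asum a -> Clim (csum a) (CSeries a).
Proof.
  intros H.
  destruct (ex_series_le (V := C_CompleteNormedModule) a _ (fun n => Rle_refl _) H) as [l Hl].
  apply is_series_csum in Hl. now rewrite (CSeries_unique _ _ Hl).
Qed.

Lemma csum_ext (a b : nat -> C) (n : nat) :
  (forall i, (i < n)%nat -> a i = b i) -> csum a n = csum b n.
Proof.
  intros H. induction n as [|n IH]; trivial. simpl.
  rewrite IH by (intros; apply H; lia). now rewrite H by lia.
Qed.

Lemma csum_plus (a b : nat -> C) (n : nat) :
  csum (fun i => a i + b i)%C n = (csum a n + csum b n)%C.
Proof. induction n as [|n IH]; simpl; [|rewrite IH]; ring. Qed.

Lemma csum_scal (c : C) (a : nat -> C) (n : nat) :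
  csum (fun i => c * a i)%C n = (c * csum a n)%C.
Proof. induction n as [|n IH]; simpl; [|rewrite IH]; ring. Qed.

Lemma csum_S (a : nat -> C) (n : nat) :
  csum a (S n) = (a O + csum (fun i => a (S i)) n)%C.
Proof.
  induction n as [|n IH]; [simpl; ring|].
  change (csum a (S (S n))) with (csum a (S n) + a (S n))%C. rewrite IH. simpl. ring.
Qed.

Lemma csum_add (a : nat -> C) (n m : nat) :
  csum a (n + m) = (csum a n + csum (fun i => a (n + i)%nat) m)%C.
Proof.
  induction m as [|m IH].
  - rewrite Nat.add_0_r. simpl. ring.
  - rewrite Nat.add_succ_r. simpl. rewrite IH. ring.
Qed.

Lemma Cmod_csum_le (a : nat -> C) (b : nat -> R) (n : nat) :
  (forall i, Cmod (a i) <= b i) -> Cmod (csum a n) <= rsum b n.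
Proof.
  intros H. induction n as [|n IH]; simpl.
  - rewrite Cmod_0. lra.
  - eapply Rle_trans; [apply Cmod_triangle|]. now apply Rplus_le_compat.
Qed.

Lemma is_lim_seq_rsum (a : nat -> R) :
  ex_series a -> is_lim_seq (rsum a) (Series a).
Proof.
  intros H. apply is_lim_seq_incr_1.
  apply is_lim_seq_ext with (sum_n a); [intros n; now rewrite rsum_sum_n|].
  exact (Series_correct _ H).
Qed.

Lemma asum_le (a : nat -> C) (b : nat -> R) :
  (forall n, Cmod (a n) <= b n) -> ex_series b -> asum a.
Proof.
  intros H. apply (ex_series_le (V := R_CompleteNormedModule)). intros n.
  change (Rabs (Cmod (a n)) <= b n).
  rewrite Rabs_pos_eq by apply Cmod_ge_0. apply H.
Qed.

Lemma Cmod_CSeries_le (a : nat -> C) (b : nat -> R) :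
  (forall n, Cmod (a n) <= b n) -> ex_series b -> Cmod (CSeries a) <= Series b.
Proof.
  intros H Hb.
  refine (is_lim_seq_le _ _ (Finite _) (Finite _) _
    (Clim_Cmod _ _ (CSeries_correct a (asum_le _ _ H Hb))) (is_lim_seq_rsum b Hb)).
  intros n. now apply Cmod_csum_le.
Qed.

Lemma CSeries_ext (a b : nat -> C) : (forall n, a n = b n) -> CSeries a = CSeries b.
Proof.
  intros H. f_equal. now apply functional_extensionality.
Qed.

Lemma asum_ext (a b : nat -> C) : (forall n, a n = b n) -> asum a -> asum b.
Proof. intros H. apply ex_series_ext. intros n. now rewrite H. Qed.

Lemma asum_plus (a b : nat -> C) : asum a -> asum b -> asum (fun n => a n + b n)%C.
Proof.
  intros Ha Hb.
  apply asum_le with (fun n => Cmod (a n) + Cmod (b n)).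
  - intros n. apply Cmod_triangle.
  - exact (ex_series_plus _ _ Ha Hb).
Qed.

Lemma asum_scal (c : C) (a : nat -> C) : asum a -> asum (fun n => c * a n)%C.
Proof.
  intros Ha. apply asum_le with (fun n => Cmod c * Cmod (a n)).
  - intros n. rewrite Cmod_mult. lra.
  - exact (ex_series_scal (V := R_NormedModule) (Cmod c) _ Ha).
Qed.

Lemma CSeries_plus (a b : nat -> C) :
  asum a -> asum b -> CSeries (fun n => a n + b n)%C = (CSeries a + CSeries b)%C.
Proof.
  intros Ha Hb. apply CSeries_unique.
  eapply Clim_ext; [intros n; symmetry; apply csum_plus|].
  apply Clim_plus; now apply CSeries_correct.
Qed.

Lemma CSeries_scal (c : C) (a : nat -> C) :
  asum a -> CSeries (fun n => c * a n)%C = (c * CSeries a)%C.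
Proof.
  intros Ha. apply CSeries_unique.
  eapply Clim_ext; [intros n; symmetry; apply csum_scal|].
  apply Clim_mult; [apply Clim_const|now apply CSeries_correct].
Qed.

Lemma CSeries_conj (a : nat -> C) :
  asum a -> CSeries (fun n => Cconj (a n)) = Cconj (CSeries a).
Proof.
  intros Ha. apply CSeries_unique.
  apply (is_lim_seq_ext (fun n => Cmod (csum a n - CSeries a)));
    [|now apply CSeries_correct].
  intros n. rewrite <- Cmod_conj, Cminus_conj. do 2 f_equal.
  induction n as [|n IH]; simpl; [|rewrite Cplus_conj, IH; reflexivity].
  unfold Cconj, RtoC. simpl. now rewrite Ropp_0.
Qed.

Lemma asum_S (a : nat -> C) : asum a -> asum (fun n => a (S n)).
Proof. apply ex_series_incr_1. Qed.

Lemma CSeries_S (a : nat -> C) :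
  asum a -> CSeries a = (a O + CSeries (fun n => a (S n)))%C.
Proof.
  intros Ha. apply (Clim_unique (fun n => csum a (S n))).
  - apply (is_lim_seq_incr_1 (fun n => Cmod (csum a n - CSeries a))).
    now apply CSeries_correct.
  - eapply Clim_ext; [intros n; symmetry; apply csum_S|].
    apply Clim_plus; [apply Clim_const|now apply CSeries_correct, asum_S].
Qed.

(** * Dominated convergence and exchange of summations *)

Lemma is_series_zero : is_series (fun _ : nat => 0) 0.
Proof.
  apply (filterlim_ext (fun _ : nat => 0)); [|apply filterlim_const].
  intros n. induction n as [|n IH]; [now rewrite sum_O|].
  rewrite sum_Sn, <- IH. unfold plus; simpl. ring.
Qed.

Lemma Series_ge_0 (a : nat -> R) : (forall n, 0 <= a n) -> ex_series a -> 0 <= Series a.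
Proof.
  intros H Ha. rewrite <- (is_series_unique _ _ is_series_zero).
  apply Series_le; trivial. intros n. split; [lra|apply H].
Qed.

(** Cut where the tail of [b] is below [eps / 2]: the tail of each [g i] is then as small, uniformly
    in [i], and the head is a finite sum of sequences tending to [0]. *)
Lemma tannery0 (g : nat -> nat -> R) (b : nat -> R) :
  ex_series b -> (forall i n, 0 <= g i n <= b n) ->
  (forall n, is_lim_seq (fun i => g i n) 0) ->
  is_lim_seq (fun i => Series (g i)) 0.
Proof.
  intros Hb Hg Hl. apply is_lim_seq_spec. intros eps.
  assert (Hex : forall i, ex_series (g i)).
  { intros i. apply (ex_series_le (V := R_CompleteNormedModule)) with b; trivial.
    intros n. change (Rabs (g i n) <= b n). rewrite Rabs_pos_eq; apply Hg. }
  assert (H2 : 0 < eps / 2) by (destruct eps; simpl; lra).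
  assert (Hs := is_lim_seq_rsum b Hb). apply is_lim_seq_spec in Hs.
  destruct (Hs (mkposreal _ H2)) as [K HK]. specialize (HK (S K) ltac:(lia)).
  simpl in HK.
  assert (HG : is_lim_seq (fun i => rsum (g i) (S K)) 0).
  { generalize (S K). intros n. induction n as [|n IH]; simpl.
    - apply is_lim_seq_const.
    - rewrite <- (Rplus_0_r 0). now apply is_lim_seq_plus'. }
  apply is_lim_seq_spec in HG.
  destruct (HG (mkposreal _ H2)) as [I HI]. exists I. intros i Hi.
  specialize (HI i Hi). simpl in HI. rewrite Rminus_0_r in HI |- *.
  assert (T1 := Series_incr_n (g i) (S K) ltac:(lia) (Hex i)).
  assert (T2 := Series_incr_n b (S K) ltac:(lia) Hb).
  rewrite <- sum_n_Reals, <- rsum_sum_n in T1, T2. simpl in T1, T2.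
  assert (T3 : 0 <= Series (fun k => g i (S (K + k))) <= Series (fun k => b (S (K + k)))).
  { split.
    - apply Series_ge_0; [intros n; apply Hg|].
      apply (ex_series_incr_n (g i) (S K)), Hex.
    - apply Series_le; [intros n; apply Hg|].
      now apply (ex_series_incr_n b (S K)). }
  apply Rabs_def2 in HI. apply Rabs_def2 in HK. apply Rabs_def1; lra.
Qed.

(** Dominated convergence for series. It reduces to [tannery0] for [|f i n - g n|], whose majorant
    is [2 b n] because the bound on [f] passes to the limit [g]. *)
Lemma tannery (f : nat -> nat -> C) (g : nat -> C) (b : nat -> R) :
  ex_series b -> (forall i n, Cmod (f i n) <= b n) ->
  (forall n, Clim (fun i => f i n) (g n)) ->
  Clim (fun i => CSeries (f i)) (CSeries g).
Proof.
  intros Hb Hf Hl.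
  assert (Hg : forall n, Cmod (g n) <= b n).
  { intros n. refine (is_lim_seq_le _ (fun _ => b n) (Finite _) (Finite _) _
      (Clim_Cmod _ _ (Hl n)) (is_lim_seq_const _)). intros i. apply Hf. }
  assert (Hb2 : ex_series (fun n => b n + b n)) by exact (ex_series_plus _ _ Hb Hb).
  assert (Hd : forall i n, Cmod (f i n + (- (1)) * g n) <= b n + b n).
  { intros i n. eapply Rle_trans; [apply Cmod_triangle|].
    rewrite Cmod_mult, Cmod_m1, Rmult_1_l. now apply Rplus_le_compat. }
  apply Clim_le with (fun i => Series (fun n => Cmod (f i n + (- (1)) * g n))).
  - intros i.
    replace (CSeries (f i) - CSeries g)%C
      with (CSeries (f i) + (- (1)) * CSeries g)%C by ring.
    assert (A1 : asum (f i)) by (apply asum_le with b; auto).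
    assert (A2 : asum g) by (apply asum_le with b; auto).
    rewrite <- CSeries_scal, <- CSeries_plus; trivial; [|now apply asum_scal].
    apply Cmod_CSeries_le; [intros n; apply Rle_refl|].
    apply asum_plus; trivial. now apply asum_scal.
  - apply tannery0 with (fun n => b n + b n); trivial.
    + intros i n. split; [apply Cmod_ge_0|apply Hd].
    + intros n. eapply is_lim_seq_ext; [|apply (Hl n)].
      intros i. simpl. f_equal. ring.
Qed.

(** The finite half of [fubini]; the second conclusion is what keeps the induction going. *)
Lemma csum_CSeries (f : nat -> nat -> C) (M : nat) :
  (forall m, asum (f m)) ->
  csum (fun m => CSeries (f m)) M = CSeries (fun n => csum (fun m => f m n) M)
  /\ asum (fun n => csum (fun m => f m n) M).
Proof.
  intros H. induction M as [|M [IH1 IH2]]; simpl.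
  - assert (A : asum (fun _ => RtoC 0)).
    { apply asum_le with (fun _ => 0); [intros; rewrite Cmod_0; lra|].
      exists 0. exact is_series_zero. }
    split; trivial.
    replace (fun n : nat => RtoC 0) with (fun n : nat => (0 * 0)%C).
    + rewrite (CSeries_scal 0 (fun _ => RtoC 0)) by trivial. ring.
    + apply functional_extensionality. intros; ring.
  - split; [|now apply asum_plus]. rewrite IH1, <- CSeries_plus; auto.
Qed.

Lemma asum_prod (f : nat -> nat -> C) (a b : nat -> R) :
  (forall m n, Cmod (f m n) <= a m * b n) -> ex_series b -> forall m, asum (f m).
Proof.
  intros H Hb m. apply asum_le with (fun n => a m * b n); trivial.
  exact (ex_series_scal (V := R_NormedModule) (a m) _ Hb).
Qed.

Lemma asum_CSeries (f : nat -> nat -> C) (a b : nat -> R) :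
  (forall m n, Cmod (f m n) <= a m * b n) -> ex_series a -> ex_series b ->
  asum (fun m => CSeries (f m)).
Proof.
  intros H Ha Hb. apply asum_le with (fun m => a m * Series b).
  - intros m. rewrite <- Series_scal_l. apply Cmod_CSeries_le; trivial.
    exact (ex_series_scal (V := R_NormedModule) (a m) _ Hb).
  - exact (ex_series_scal_r (Series b) _ Ha).
Qed.

(** For finitely many rows the exchange is [csum_CSeries]. The number of rows then tends to infinity
    by [tannery], since all column sums are bounded by [Series a * b n]. *)
Lemma fubini (f : nat -> nat -> C) (a b : nat -> R) :
  (forall m n, Cmod (f m n) <= a m * b n) -> ex_series a -> ex_series b ->
  (forall n, 0 <= a n) -> (forall n, 0 <= b n) ->
  CSeries (fun m => CSeries (f m)) = CSeries (fun n => CSeries (fun m => f m n)).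
Proof.
  intros H Ha Hb Pa Pb. apply CSeries_unique.
  eapply Clim_ext; [intros M; symmetry; apply csum_CSeries; eapply asum_prod; eauto|].
  apply tannery with (fun n => Series a * b n).
  - exact (ex_series_scal (V := R_NormedModule) (Series a) _ Hb).
  - intros M n. apply Rle_trans with (rsum a M * b n).
    + induction M as [|M IH]; simpl.
      * rewrite Cmod_0. lra.
      * eapply Rle_trans; [apply Cmod_triangle|].
        rewrite Rmult_plus_distr_r. now apply Rplus_le_compat.
    + apply Rmult_le_compat_r; [apply Pb|].
      refine (is_lim_seq_incr_compare (rsum a) _ (is_lim_seq_rsum a Ha) _ M).
      intros p. simpl. specialize (Pa p). lra.
  - intros n. apply CSeries_correct.
    apply asum_le with (fun m => a m * b n); [intros; apply H|].
    exact (ex_series_scal_r (b n) _ Ha).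
Qed.

(** * The binomial series and Lambert series *)

Lemma ex_series_poly_geom (j : nat) (c r : R) :
  0 < c -> 0 <= r < 1 -> ex_series (fun n => (INR n + c) ^ j * r ^ n).
Proof.
  intros Hc Hr.
  assert (Hn : forall n, 0 < INR n + c) by (intros n; assert (T := pos_INR n); lra).
  (* The ratio test needs nonzero terms, hence [r = 0] apart. *)
  destruct (Req_dec r 0) as [->|Hr0].
  { apply ex_series_incr_1. exists 0. eapply is_series_ext; [|apply is_series_zero].
    intros n. simpl. ring. }
  apply ex_series_ext with (fun n => Rabs ((INR n + c) ^ j * r ^ n)).
  { intros n. apply Rabs_pos_eq, Rmult_le_pos; apply pow_le; [apply Rlt_le, Hn|lra]. }
  apply ex_series_DAlembert with r; [lra| |].
  { intros n. apply Rmult_integral_contrapositive. split; apply pow_nonzero; [|lra].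
    specialize (Hn n). lra. }
  apply is_lim_seq_ext with (fun n => (1 + / (INR n + c)) ^ j * r).
  { intros n. specialize (Hn n). rewrite S_INR.
    assert (Hp := pow_lt _ j Hn). assert (Hrn : 0 < r ^ n) by (apply pow_lt; lra).
    rewrite Rabs_pos_eq.
    - replace (1 + / (INR n + c)) with ((INR n + 1 + c) / (INR n + c)) by (field; lra).
      unfold Rdiv at 1. rewrite Rpow_mult_distr, pow_inv. simpl. field. lra.
    - apply Rdiv_le_0_compat; [|now apply Rmult_lt_0_compat].
      apply Rmult_le_pos; apply pow_le; lra. }
  assert (H1 : is_lim_seq (fun n => 1 + / (INR n + c)) 1).
  { replace (Finite 1) with (Finite (1 + 0)) by (f_equal; ring). apply is_lim_seq_plus'; [apply is_lim_seq_const|].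
    apply (is_lim_seq_inv _ p_infty); [|discriminate].
    apply is_lim_seq_plus with p_infty (Finite c); [apply is_lim_seq_INR|apply is_lim_seq_const|reflexivity]. }
  replace (Finite r) with (Finite (1 * r)) by (f_equal; ring). apply is_lim_seq_mult'; [|apply is_lim_seq_const].
  induction j as [|j IH]; simpl; [apply is_lim_seq_const|].
  replace (Finite 1) with (Finite (1 * 1)) by (f_equal; ring). now apply is_lim_seq_mult'.
Qed.

Lemma INR_S_pos (n : nat) : 0 < INR (S n).
Proof. apply lt_0_INR. lia. Qed.

(* [mchoose j n = binom (n + j) j], for real [n] *)
Fixpoint mchoose (j : nat) (x : R) : R :=
  match j with
  | O => 1
  | S i => mchoose i x * ((x + INR (S i)) / INR (S i))
  end.

Lemma mchoose_pos (j : nat) (x : R) : 0 <= x -> 0 < mchoose j x.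
Proof.
  intros Hx. induction j as [|j IH]; [simpl; lra|]. cbn [mchoose].
  assert (T := INR_S_pos j). apply Rmult_lt_0_compat; trivial.
  apply Rdiv_lt_0_compat; lra.
Qed.

(** The bound is free of [N] because it serves as a majorant while [N] tends to infinity. Each
    scaled factor is [(x + i/N) / i], which is at most [x + 1]. *)
Lemma mchoose_scaled (j N : nat) (x : R) :
  (1 <= N)%nat -> 0 <= x -> 0 <= mchoose j (x * INR N) / INR N ^ j <= (x + INR (S j)) ^ j.
Proof.
  intros HN Hx. apply (le_INR 1) in HN. change (INR 1) with 1 in HN.
  induction j as [|j [IH1 IH2]]; [simpl; lra|]. cbn [mchoose].
  assert (Hj : 1 <= INR (S j)) by (rewrite S_INR; assert (T := pos_INR j); lra).
  assert (HNj : 0 < INR N ^ j) by (apply pow_lt; lra).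
  replace (mchoose j (x * INR N) * ((x * INR N + INR (S j)) / INR (S j)) / INR N ^ S j)
    with (mchoose j (x * INR N) / INR N ^ j * ((x + INR (S j) / INR N) / INR (S j)))
    by (simpl pow; field; repeat split; lra).
  assert (H1 : 0 <= INR (S j) / INR N <= INR (S j)).
  { split; [apply Rdiv_le_0_compat; lra|].
    apply Rle_div_l; [lra|]. rewrite <- (Rmult_1_r (INR (S j))) at 1. apply Rmult_le_compat_l; lra. }
  assert (H2 : 0 <= (x + INR (S j) / INR N) / INR (S j) <= x + INR (S (S j))).
  { split; [apply Rdiv_le_0_compat; lra|].
    apply Rle_div_l; [lra|]. rewrite (S_INR (S j)). nra. }
  split; [now apply Rmult_le_pos|].
  rewrite <- tech_pow_Rmult, Rmult_comm.
  apply Rmult_le_compat; try tauto.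
  eapply Rle_trans; [apply IH2|]. apply pow_incr. rewrite (S_INR (S j)). lra.
Qed.

(** The scaled factors [(x + i/N) / i] tend to [x / i]; this is the origin of the coefficients
    [l^(k-1) / (k-1)!] in Lipschitz' formula. *)
Lemma mchoose_scaled_lim (j : nat) (x : R) (phi : nat -> nat) :
  (forall n, (1 <= phi n)%nat) -> is_lim_seq (fun n => / INR (phi n)) 0 ->
  is_lim_seq (fun n => mchoose j (x * INR (phi n)) / INR (phi n) ^ j) (x ^ j / INR (fact j)).
Proof.
  intros Hphi Hl. induction j as [|j IH].
  - simpl. apply is_lim_seq_const.
  - assert (Hj : 1 <= INR (S j)) by (rewrite S_INR; assert (T := pos_INR j); lra).
    replace (x ^ S j / INR (fact (S j))) with (x ^ j / INR (fact j) * ((x + INR (S j) * 0) * / INR (S j))).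
    2:{ rewrite fact_simpl, mult_INR. simpl pow. assert (T := INR_fact_neq_0 j). field. split; lra. }
    apply is_lim_seq_ext with (fun n => mchoose j (x * INR (phi n)) / INR (phi n) ^ j
      * ((x + INR (S j) * / INR (phi n)) * / INR (S j))).
    { intros n. assert (T := Hphi n). apply (le_INR 1) in T. change (INR 1) with 1 in T.
      assert (HNj : 0 < INR (phi n) ^ j) by (apply pow_lt; lra).
      cbn [mchoose]. simpl pow. field. repeat split; lra. }
    apply is_lim_seq_mult'; trivial.
    apply is_lim_seq_mult'; [|apply is_lim_seq_const].
    apply is_lim_seq_plus'; [apply is_lim_seq_const|].
    apply is_lim_seq_mult'; trivial. apply is_lim_seq_const.
Qed.

Lemma mchoose_0 (j : nat) : mchoose j 0 = 1.
Proof.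
  induction j as [|j IH]; trivial. cbn [mchoose]. rewrite IH.
  assert (T := INR_S_pos j). field. lra.
Qed.

(** Pascal's rule for real arguments. It follows from the absorption rule [H], which relates
    [mchoose j] at [x + 1] and at [x]. *)
Lemma mchoose_pascal (j : nat) (x : R) :
  mchoose (S j) (x + 1) = mchoose (S j) x + mchoose j (x + 1).
Proof.
  assert (H : forall j, mchoose j (x + 1) * (x + 1) = mchoose j x * (x + 1 + INR j)).
  { clear j. induction j as [|j IH]; [simpl; ring|]. cbn [mchoose].
    assert (T := INR_S_pos j).
    transitivity (mchoose j (x + 1) * (x + 1) * ((x + 1 + INR (S j)) / INR (S j))).
    - field. lra.
    - rewrite IH, S_INR. rewrite S_INR in T. field. lra. }
  specialize (H j). cbn [mchoose]. assert (T := INR_S_pos j). rewrite S_INR in *.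
  apply Rmult_eq_reg_r with (INR j + 1); [|lra].
  transitivity (mchoose j (x + 1) * (x + 1 + (INR j + 1))); [field; lra|].
  transitivity (mchoose j x * (x + 1 + INR j) + mchoose j (x + 1) * (INR j + 1)); [|field; lra].
  rewrite <- H. ring.
Qed.

Lemma asum_mchoose (j : nat) (u : C) :
  Cmod u < 1 -> asum (fun n => mchoose j (INR n) * u ^ n)%C.
Proof.
  intros Hu. apply asum_le with (fun n => (INR n + INR (S j)) ^ j * Cmod u ^ n).
  - intros n. rewrite Cmod_mult, Cmod_pow, Cmod_R.
    assert (T := mchoose_scaled j 1 (INR n) (le_n 1) (pos_INR n)).
    change (INR 1) with 1 in T. rewrite pow1, Rmult_1_r, Rdiv_1_r in T.
    rewrite Rabs_pos_eq by apply T. apply Rmult_le_compat_r; [apply pow_le, Cmod_ge_0|apply T].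
  - apply ex_series_poly_geom; [apply INR_S_pos|]. split; [apply Cmod_ge_0|exact Hu].
Qed.

Lemma one_minus_neq_0 (u : C) : Cmod u < 1 -> (1 - u)%C <> 0.
Proof.
  intros Hu E. replace u with (1 - (1 - u))%C in Hu by ring.
  rewrite E in Hu. replace (1 - 0)%C with (RtoC 1) in Hu by ring. rewrite Cmod_1 in Hu. lra.
Qed.

(** Multiplying a power series by [1 - u] replaces its coefficients by their differences ([Step]),
    and by Pascal's rule the differences of the coefficients for [S j] are the coefficients for
    [j]. *)
Lemma negative_binomial (j : nat) (u : C) :
  Cmod u < 1 -> CSeries (fun n => mchoose j (INR n) * u ^ n)%C = (/ (1 - u) ^ S j)%C.
Proof.
  intros Hu. assert (H1 := one_minus_neq_0 u Hu).
  assert (Step : forall b : nat -> R, b O = 1 ->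
    asum (fun n => b n * u ^ n)%C ->
    asum (fun n => (b (S n) - b n)%R * u ^ S n)%C ->
    CSeries (fun n => b n * u ^ n)%C
    = ((1 + CSeries (fun n => (b (S n) - b n)%R * u ^ S n)) / (1 - u))%C).
  { intros b Hb0 Hb Hd.
    assert (E1 := CSeries_S _ Hb). simpl in E1. rewrite Hb0 in E1.
    assert (E2 := CSeries_scal u _ Hb). assert (A2 := asum_scal u _ Hb).
    assert (E3 : CSeries (fun n => b (S n) * (u * u ^ n))%C
      = (CSeries (fun n => u * (b n * u ^ n)) + CSeries (fun n => (b (S n) - b n)%R * u ^ S n))%C).
    { rewrite <- CSeries_plus; trivial. apply CSeries_ext. intros n.
      rewrite RtoC_minus. simpl. ring. }
    rewrite E3, E2 in E1.
    set (X := CSeries (fun n => b n * u ^ n)%C) in *.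
    set (Y := CSeries (fun n => (b (S n) - b n)%R * u ^ S n)%C) in *.
    assert (E4 : (X * (1 - u) = 1 + Y)%C).
    { replace (X * (1 - u))%C with (X - u * X)%C by ring.
      rewrite E1 at 1. ring. }
    rewrite <- E4. field. exact H1. }
  induction j as [|j IH].
  - rewrite (Step (fun n => mchoose 0 (INR n))); trivial.
    + cbn [mchoose]. rewrite (CSeries_ext _ (fun n => 0 * 0)%C).
      2:{ intros n. rewrite Rminus_diag. ring. }
      rewrite (CSeries_scal 0 (fun _ => RtoC 0)).
      * simpl. field. exact H1.
      * apply asum_le with (fun _ => 0); [intros; rewrite Cmod_0; lra|].
        exists 0. apply is_series_zero.
    + now apply asum_mchoose.
    + cbn [mchoose]. apply asum_le with (fun _ => 0); [|exists 0; apply is_series_zero].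
      intros n. rewrite Rminus_diag, Cmult_0_l, Cmod_0. lra.
  - assert (Hx : forall n, mchoose (S j) (INR (S n)) - mchoose (S j) (INR n) = mchoose j (INR (S n))).
    { intros n. rewrite S_INR, mchoose_pascal. ring. }
    assert (A := asum_mchoose j u Hu).
    rewrite (Step (fun n => mchoose (S j) (INR n))).
    + rewrite (CSeries_ext _ (fun n => mchoose j (INR (S n)) * u ^ S n)%C)
        by (intros n; now rewrite Hx).
      assert (E := CSeries_S _ A). cbv beta in E. change (INR 0) with 0 in E. rewrite mchoose_0 in E.
      change (u ^ 0)%C with (RtoC 1) in E.
      replace (1 * 1)%C with (RtoC 1) in E by ring.
      rewrite <- E, IH. simpl. field. split; trivial. now apply Cpow_nz.
    + simpl INR. apply mchoose_0.
    + now apply asum_mchoose.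
    + apply asum_ext with (fun n => mchoose j (INR (S n)) * u ^ S n)%C;
        [intros n; now rewrite Hx|].
      now apply asum_S in A.
Qed.

Lemma csum_zero (a : nat -> C) (n : nat) : (forall i, (i < n)%nat -> a i = 0) -> csum a n = 0.
Proof.
  intros H. induction n as [|n IH]; trivial. simpl.
  rewrite IH, H by (intros; try apply H; lia). ring.
Qed.

(** A partial sum of length [L N] consists of [L] blocks, in each of which only the first term
    survives. *)
Lemma CSeries_sparse (c : nat -> C) (N : nat) :
  (1 <= N)%nat ->
  asum (fun n => if Nat.eqb (n mod N) 0 then c n else 0) ->
  CSeries (fun n => if Nat.eqb (n mod N) 0 then c n else 0) = CSeries (fun l => c (l * N)%nat).
Proof.
  intros HN H. symmetry. apply CSeries_unique.
  apply Clim_ext with (fun L => csum (fun n => if Nat.eqb (n mod N) 0 then c n else 0) (L * N)).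
  - intros L. induction L as [|L IH]; trivial.
    replace (S L * N)%nat with (L * N + N)%nat by lia.
    rewrite csum_add, IH. simpl. f_equal.
    destruct N as [|N]; [lia|]. rewrite csum_S, csum_zero.
    + rewrite Nat.add_0_r, Nat.Div0.mod_mul. simpl. ring.
    + intros i Hi. rewrite Nat.add_comm, Nat.Div0.mod_add, Nat.mod_small by lia. reflexivity.
  - apply (Clim_subseq _ _ (fun L => (L * N)%nat)).
    + apply eventually_subseq. intros n. lia.
    + now apply CSeries_correct.
Qed.

Lemma CSeries_finite (a : nat -> C) (K : nat) :
  (forall n, (K <= n)%nat -> a n = 0) -> CSeries a = csum a K.
Proof.
  intros H. apply CSeries_unique.
  apply (is_lim_seq_ext_loc (fun _ => 0)); [|apply is_lim_seq_const].
  exists K. intros n Hn. replace n with (K + (n - K))%nat by lia.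
  rewrite csum_add, (csum_zero (fun i => a (K + i)%nat)) by (intros; apply H; lia).
  replace (csum a K + 0 - csum a K)%C with (RtoC 0) by ring. now rewrite Cmod_0.
Qed.

Lemma sigma_div_csum (j n : nat) :
  RtoC (INR (sigma_div j n))
  = csum (fun d => if Nat.eqb (n mod S d) 0 then RtoC (INR (S d) ^ j) else 0) n.
Proof.
  (* The number [n] is both the range of the divisors and the number divided; only the range is
     generalized, for the induction. *)
  unfold sigma_div. generalize n at 2 4. intros m.
  induction m as [|m IH]; trivial.
  rewrite seq_S, filter_app, map_app, list_sum_app, plus_INR, RtoC_plus, IH.
  cbn [csum]. f_equal. simpl Nat.add. cbn [filter].
  destruct (Nat.eqb (n mod S m) 0); trivial.
  cbn [map list_sum fold_right]. rewrite Nat.add_0_r, pow_INR. reflexivity.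
Qed.

(** Two exchanges: from [n] outside and its divisors [d] inside to [d] outside, where the multiples
    of [d] are re-indexed as [n = m d], and then from [d] to [m] outside. *)
Lemma lambert_series (j : nat) (q : C) :
  Cmod q < 1 ->
  CSeries (fun n => INR (sigma_div j (S n)) * q ^ S n)%C
  = CSeries (fun m => CSeries (fun d => INR (S d) ^ j * (q ^ S m) ^ S d))%C.
Proof.
  (* The square root shares the decay between two indices: if [a <= c] and [b <= c] then
     [|q|^c = s^c s^c <= s^a s^b], a product majorant for [fubini]. *)
  intros Hq. set (s := sqrt (Cmod q)).
  assert (Hs : 0 <= s < 1).
  { split; [apply sqrt_pos|]. rewrite <- sqrt_1. apply sqrt_lt_1_alt.
    split; [apply Cmod_ge_0|trivial]. }
  assert (Hss : Cmod q = s * s) by (symmetry; apply sqrt_sqrt, Cmod_ge_0).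
  assert (Hpow : forall a b c, (a <= c)%nat -> (b <= c)%nat -> Cmod q ^ c <= s ^ a * s ^ b).
  { intros a b c Ha Hb. rewrite Hss, Rpow_mult_distr.
    assert (M : forall e, (e <= c)%nat -> s ^ c <= s ^ e).
    { intros e He. replace c with (e + (c - e))%nat by lia. rewrite pow_add.
      rewrite <- (Rmult_1_r (s ^ e)) at 2. apply Rmult_le_compat_l; [now apply pow_le|].
      rewrite <- (pow1 (c - e)). apply pow_incr. lra. }
    apply Rmult_le_compat; auto; now apply pow_le. }
  assert (Xa : ex_series (fun d => INR (S d) ^ j * s ^ S d)).
  { apply ex_series_ext with (fun d => s * ((INR d + 1) ^ j * s ^ d)).
    - intros d. rewrite S_INR. simpl. ring.
    - apply (ex_series_scal (V := R_NormedModule)), ex_series_poly_geom; lra. }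
  assert (Xb : ex_series (fun n => s ^ S n)).
  { apply ex_series_incr_1 with (a := fun n => s ^ n), ex_series_geom. now rewrite Rabs_pos_eq. }
  assert (Pa : forall d, 0 <= INR (S d) ^ j * s ^ S d).
  { intros d. apply Rmult_le_pos; apply pow_le; [apply pos_INR|apply Hs]. }
  assert (Pb : forall n, 0 <= s ^ S n) by (intros; now apply pow_le).
  set (f := fun d n => if Nat.eqb (S n mod S d) 0 then (INR (S d) ^ j * q ^ S n)%C else 0).
  assert (Hmod : forall d n, Cmod (INR (S d) ^ j * q ^ n) = INR (S d) ^ j * Cmod q ^ n).
  { intros d n. rewrite Cmod_mult, !Cmod_pow, Cmod_R, Rabs_pos_eq; trivial. apply pos_INR. }
  assert (Hf : forall d n, Cmod (f d n) <= INR (S d) ^ j * s ^ S d * s ^ S n).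
  { intros d n. unfold f. destruct (Nat.eqb_spec (S n mod S d) 0) as [E|_].
    - rewrite Hmod, Rmult_assoc. apply Rmult_le_compat_l; [apply pow_le, pos_INR|].
      apply Hpow; [|lia]. apply Nat.Div0.mod_divides in E. destruct E as [c E].
      destruct c; [lia|]. rewrite E. nia.
    - rewrite Cmod_0. now apply Rmult_le_pos. }
  transitivity (CSeries (fun n => CSeries (fun d => f d n))).
  { apply CSeries_ext. intros n. rewrite (CSeries_finite _ (S n)).
    - rewrite sigma_div_csum, Cmult_comm, <- csum_scal. apply csum_ext.
      intros i _. unfold f. rewrite RtoC_pow. destruct (Nat.eqb (S n mod S i) 0); ring.
    - intros d Hd. unfold f. now rewrite Nat.mod_small by lia. }
  rewrite <- (fubini f _ _ Hf Xa Xb Pa Pb).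
  transitivity (CSeries (fun d => CSeries (fun m => INR (S d) ^ j * (q ^ S m) ^ S d)))%C.
  - apply CSeries_ext. intros d.
    (* [g] starts at [n = 0], as [CSeries_sparse] requires; the extra term at [0] is afterwards
       cancelled on both sides. *)
    set (g := fun n => if Nat.eqb (n mod S d) 0 then (INR (S d) ^ j * q ^ n)%C else 0).
    assert (Ag : asum g).
    { unfold asum. apply ex_series_incr_1.
      exact (asum_prod f _ _ Hf Xb d). }
    assert (Ah : asum (fun m => INR (S d) ^ j * q ^ (m * S d))%C).
    { apply asum_le with (fun m => INR (S d) ^ j * Cmod q ^ m).
      - intros m. rewrite Hmod. apply Rmult_le_compat_l; [apply pow_le, pos_INR|].
        replace (m * S d)%nat with (m + m * d)%nat by lia. rewrite pow_add.
        rewrite <- (Rmult_1_r (Cmod q ^ m)) at 2. apply Rmult_le_compat_l; [apply pow_le, Cmod_ge_0|].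
        rewrite <- (pow1 (m * d)). apply pow_incr. split; [apply Cmod_ge_0|lra].
      - apply (ex_series_scal (V := R_NormedModule)), ex_series_geom.
        rewrite Rabs_pos_eq; trivial. apply Cmod_ge_0. }
    assert (E : CSeries g = CSeries (fun m => INR (S d) ^ j * q ^ (m * S d))%C)
      by exact (CSeries_sparse (fun n => INR (S d) ^ j * q ^ n)%C (S d) ltac:(lia) Ag).
    rewrite (CSeries_S _ Ag), (CSeries_S _ Ah) in E.
    replace (g O) with (INR (S d) ^ j * q ^ (0 * S d))%C in E
      by (unfold g; now rewrite Nat.Div0.mod_0_l).
    apply (f_equal (fun t => (- (INR (S d) ^ j * q ^ (0 * S d)) + t)%C)) in E.
    rewrite !Cplus_assoc, !(Cplus_comm (- _)), !Cplus_opp_r, !Cplus_0_l in E.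
    etransitivity; [exact E|]. apply CSeries_ext. intros m. now rewrite Cpow_mult_r.
  - apply (fubini (fun d m => INR (S d) ^ j * (q ^ S m) ^ S d)%C
      (fun d => INR (S d) ^ j * s ^ S d) (fun n => s ^ S n)); trivial.
    intros d m. rewrite <- Cpow_mult_r, Hmod, Rmult_assoc. apply Rmult_le_compat_l; [apply pow_le, pos_INR|].
    apply Hpow; nia.
Qed.

(** * Lipschitz' formula *)

Lemma Cexp_plus (a b : C) : Cexp (a + b) = (Cexp a * Cexp b)%C.
Proof.
  destruct a as [x y], b as [x' y'].
  unfold Cexp, Cmult, Cplus. simpl. rewrite exp_plus, cos_plus, sin_plus. f_equal; ring.
Qed.

Lemma Cexp_0 : Cexp 0 = 1.
Proof. unfold Cexp. simpl. rewrite exp_0, cos_0, sin_0. unfold RtoC. f_equal; ring. Qed.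

Lemma Cmod_Cexp (a : C) : Cmod (Cexp a) = exp (Re a).
Proof.
  unfold Cmod, Cexp. cbn [fst snd].
  assert (T := sin2_cos2 (Im a)). unfold Rsqr in T.
  replace ((exp (Re a) * cos (Im a)) ^ 2 + (exp (Re a) * sin (Im a)) ^ 2)
    with (exp (Re a) ^ 2 * (sin (Im a) * sin (Im a) + cos (Im a) * cos (Im a))) by ring.
  rewrite T, Rmult_1_r, sqrt_pow2; trivial. apply Rlt_le, exp_pos.
Qed.

Lemma nome_plus (a b : C) : nome (a + b) = (nome a * nome b)%C.
Proof. unfold nome. rewrite <- Cexp_plus. f_equal. ring. Qed.

Lemma nome_0 : nome 0 = 1.
Proof. unfold nome. rewrite Cmult_0_r. apply Cexp_0. Qed.

Lemma nome_mult_INR (n : nat) (a : C) : nome (INR n * a) = (nome a ^ n)%C.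
Proof.
  induction n as [|n IH].
  - simpl INR. rewrite Cmult_0_l. apply nome_0.
  - rewrite S_INR, RtoC_plus, Cpow_S, <- IH, <- nome_plus. f_equal. ring.
Qed.

Lemma nome_1 : nome 1 = 1.
Proof.
  unfold nome. replace (2 * PI * Ci * 1)%C with ((0, 2 * PI) : C).
  - unfold Cexp. simpl. rewrite exp_0, cos_2PI, sin_2PI. unfold RtoC. f_equal; ring.
  - unfold Ci, Cmult, RtoC. simpl. f_equal; ring.
Qed.

Lemma nome_INR (n : nat) : nome (INR n) = 1.
Proof. rewrite <- (Cmult_1_r (INR n)), nome_mult_INR, nome_1. apply Cpow_1_l. Qed.

Lemma nome_pair (x y : R) :
  nome (x, y) = (exp (- (2 * PI * y)) * cos (2 * PI * x), exp (- (2 * PI * y)) * sin (2 * PI * x)).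
Proof.
  unfold nome, Cexp, Ci, Cmult, RtoC. simpl. f_equal; (f_equal; [f_equal; ring|f_equal; ring]).
Qed.

Lemma Cmod_nome (t : C) : Cmod (nome t) = exp (- (2 * PI * Im t)).
Proof. unfold nome. rewrite Cmod_Cexp. f_equal. unfold Re, Im, Cmult, RtoC, Ci. simpl. ring. Qed.

Lemma Cmod_nome_lt_1 (t : C) : 0 < Im t -> Cmod (nome t) < 1.
Proof.
  intros H. rewrite Cmod_nome, <- exp_0. apply exp_increasing.
  assert (T := PI_RGT_0). nra.
Qed.

Lemma cos_neq_1 (x : R) : 0 < x < 2 * PI -> cos x <> 1.
Proof.
  intros Hx E. assert (H : 0 < sin (x / 2)) by (apply sin_gt_0; lra).
  replace x with (2 * (x / 2)) in E by field. rewrite cos_2a_sin in E. nra.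
Qed.

Lemma nome_root (n N : nat) :
  (1 <= N)%nat -> (nome (/ INR N)%R ^ n)%C = nome (INR n / INR N)%R.
Proof.
  intros HN. rewrite <- nome_mult_INR. f_equal. unfold Rdiv. now rewrite RtoC_mult.
Qed.

(** Only [n mod N] matters, and its angle lies strictly between [0] and [2 PI]. *)
Lemma nome_root_neq_1 (n N : nat) :
  (1 <= N)%nat -> (n mod N <> 0)%nat -> (nome (/ INR N)%R ^ n)%C <> 1.
Proof.
  intros HN Hn. assert (HN' : 0 < INR N) by (apply lt_0_INR; lia).
  rewrite (Nat.div_mod_eq n N), Cpow_add_r, Cpow_mult_r, (nome_root N) by trivial.
  rewrite Rdiv_diag, nome_1, Cpow_1_l, Cmult_1_l, nome_root by (trivial; lra).
  intros E. unfold RtoC in E. rewrite nome_pair in E. injection E. intros _.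
  rewrite Rmult_0_r, Ropp_0, exp_0, Rmult_1_l. apply cos_neq_1.
  assert (Hlt : INR (n mod N) < INR N) by (apply lt_INR, Nat.mod_upper_bound; lia).
  assert (Hpos : 0 < INR (n mod N)) by (apply lt_0_INR; lia).
  assert (T := PI_RGT_0).
  assert (0 < INR (n mod N) / INR N < 1).
  { split; [now apply Rdiv_lt_0_compat|]. apply Rlt_div_l; lra. }
  split; nra.
Qed.

Lemma csum_geom (x : C) (n : nat) : ((1 - x) * csum (fun i => x ^ i) n = 1 - x ^ n)%C.
Proof.
  induction n as [|n IH]; simpl; [ring|].
  rewrite Cmult_plus_distr_l, IH. ring.
Qed.

Lemma csum_const (c : C) (n : nat) : csum (fun _ => c) n = (INR n * c)%C.
Proof.
  induction n as [|n IH]; [simpl; ring|].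
  rewrite S_INR, RtoC_plus. simpl csum. rewrite IH. ring.
Qed.

(** If the root [r] is not [1], the geometric sum satisfies [(1 - r) sum = 1 - r^N = 0]. *)
Lemma root_of_unity_filter (n N : nat) :
  (1 <= N)%nat ->
  csum (fun i => (nome (/ INR N)%R ^ n) ^ i)%C N
  = if Nat.eqb (n mod N) 0 then RtoC (INR N) else 0.
Proof.
  intros HN. assert (HN' : INR N <> 0) by (apply not_0_INR; lia).
  destruct (Nat.eqb_spec (n mod N) 0) as [E|E].
  - rewrite (csum_ext _ (fun _ => 1)).
    + rewrite csum_const. ring.
    + intros i _. apply Nat.Div0.mod_divides in E. destruct E as [c ->].
      rewrite nome_root, mult_INR by trivial.
      replace (INR N * INR c / INR N) with (INR c) by (field; trivial).
      now rewrite nome_INR, Cpow_1_l.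
  - assert (G := csum_geom (nome (/ INR N)%R ^ n) N).
    rewrite <- Cpow_mult_r, Nat.mul_comm, Cpow_mult_r, (nome_root N) in G by trivial.
    rewrite Rdiv_diag, nome_1, Cpow_1_l in G by trivial.
    apply nome_root_neq_1 in E; trivial.
    replace (1 - 1)%C with (RtoC 0) in G by ring.
    destruct (Ceq_dec (csum (fun i => (nome (/ INR N)%R ^ n) ^ i)%C N) 0) as [Z|Z]; trivial.
    exfalso. refine (Cmult_neq_0 _ _ _ Z G). intros H. apply E.
    replace (nome (/ INR N)%R ^ n)%C with (1 - (1 - nome (/ INR N)%R ^ n))%C by ring.
    rewrite H. ring.
Qed.

(** Pairing [j] with [-j] gives the finite sum the shape of the two-sided series in [lipschitz]. *)
Lemma csum_symmetric (g : R -> C) (M : nat) :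
  csum (fun i => g (INR i - INR M)) (2 * M + 1)
  = (g 0 + csum (fun j => g (INR (S j)) + g (- INR (S j))%R) M)%C.
Proof.
  assert (H : forall h : R -> C, csum (fun i => h (INR i - INR M)) (2 * M + 1)
     = (csum (fun j => h (- INR (S j))%R) M + (h 0 + csum (fun j => h (INR (S j))) M))%C).
  { intros h. replace (2 * M + 1)%nat with (M + S M)%nat by lia.
    rewrite csum_add, (csum_S (fun i => h (INR (M + i) - INR M))).
    f_equal; [|f_equal].
    - clear. revert h. induction M as [|M IH]; intros h; trivial.
      rewrite csum_S. cbn [csum]. rewrite <- IH, Cplus_comm. f_equal.
      + apply csum_ext. intros i _. f_equal. rewrite !S_INR. ring.
      + f_equal. change (INR 0) with 0. ring.
    - f_equal. rewrite Nat.add_0_r. ring.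
    - apply csum_ext. intros i _. f_equal. rewrite plus_INR. ring. }
  rewrite H, csum_plus. ring.
Qed.


(** The shift by [M] multiplies every [nome] by one fixed [N]-th root of unity, so the right side
    does not see it: [w ^ N] is still [nome tau]. Its purpose is to centre the indices before the
    limit. *)
Lemma lipschitz_finite (j N M : nat) (tau : C) :
  (1 <= N)%nat -> 0 < Im tau ->
  csum (fun i => (/ (INR N * (1 - nome ((tau + (INR i - INR M)%R) * (/ INR N)%R)))) ^ S j)%C N
  = CSeries (fun l => (mchoose j (INR l * INR N) / INR N ^ j)%R * nome tau ^ l)%C.
Proof.
  intros HN Ht. assert (HN' : 0 < INR N) by (apply lt_0_INR; lia).
  assert (HNC : RtoC (INR N) <> 0) by (intros E; apply RtoC_inj in E; lra).
  set (w := nome ((tau - INR M) * (/ INR N)%R)). set (z := nome (/ INR N)%R).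
  assert (Hw : Cmod w < 1).
  { apply Cmod_nome_lt_1. destruct tau as [x y]. simpl in *.
    assert (T := Rinv_0_lt_compat _ HN'). nra. }
  assert (Hz : Cmod z = 1).
  { unfold z. rewrite Cmod_nome. simpl. rewrite Rmult_0_r, Ropp_0. apply exp_0. }
  assert (HwN : (w ^ N = nome tau)%C).
  { unfold w. rewrite <- nome_mult_INR.
    replace tau with ((tau - INR M) + INR M)%C at 2 by ring.
    rewrite (nome_plus _ (INR M)), nome_INR, Cmult_1_r. f_equal.
    rewrite RtoC_inv by lra. field. trivial. }
  assert (Hu : forall i, Cmod (w * z ^ i) < 1).
  { intros i. now rewrite Cmod_mult, Cmod_pow, Hz, pow1, Rmult_1_r. }
  set (f := fun i n => (mchoose j (INR n) * (w * z ^ i) ^ n)%C).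
  set (c := fun n => (INR N * (mchoose j (INR n) * w ^ n))%C).
  assert (Af : forall i, asum (f i)) by (intros; now apply asum_mchoose).
  destruct (csum_CSeries f N Af) as [E1 A1].
  assert (E2 : forall n, csum (fun i => f i n) N = if Nat.eqb (n mod N) 0 then c n else 0).
  { intros n. unfold f. rewrite (csum_ext _ (fun i => (mchoose j (INR n) * w ^ n) * (z ^ n) ^ i))%C.
    - rewrite csum_scal. unfold z. rewrite root_of_unity_filter by trivial.
      unfold c. destruct (Nat.eqb (n mod N) 0); ring.
    - intros i _. rewrite Cpow_mult_l, <- !Cpow_mult_r, (Nat.mul_comm i). ring. }
  transitivity (csum (fun i => (/ INR N) ^ S j * CSeries (f i))%C N).
  { apply csum_ext. intros i _. unfold f. rewrite negative_binomial by apply Hu.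
    replace (nome ((tau + (INR i - INR M)%R) * (/ INR N)%R)) with (w * z ^ i)%C.
    - rewrite <- (Cpow_inv (1 - w * z ^ i)), <- Cpow_mult_l by apply one_minus_neq_0, Hu.
      f_equal. field. split; trivial. apply one_minus_neq_0, Hu.
    - unfold w, z. rewrite <- nome_mult_INR, <- nome_plus. f_equal.
      rewrite RtoC_minus. ring. }
  rewrite csum_scal, E1, (CSeries_ext _ _ E2), CSeries_sparse; trivial.
  2:{ now apply (asum_ext _ _ E2). }
  assert (Ac : asum (fun l => c (l * N)%nat)).
  { apply asum_le with (fun l => INR N * INR N ^ j * ((INR l + INR (S j)) ^ j * Cmod (nome tau) ^ l)).
    - intros l. unfold c. rewrite !Cmod_mult, Nat.mul_comm, Cpow_mult_r, HwN, Cmod_pow, !Cmod_R.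
      rewrite mult_INR, (Rmult_comm (INR N)).
      assert (T := mchoose_scaled j N (INR l) HN (pos_INR l)).
      assert (HNj : 0 < INR N ^ j) by now apply pow_lt.
      rewrite (Rabs_pos_eq (INR N)), (Rabs_pos_eq (mchoose _ _)) by
        (try apply Rlt_le, mchoose_pos, Rmult_le_pos; try apply pos_INR; lra).
      rewrite Rmult_assoc, <- (Rmult_assoc (INR N ^ j)).
      apply Rmult_le_compat_l; [lra|]. apply Rmult_le_compat_r; [apply pow_le, Cmod_ge_0|].
      rewrite (Rmult_comm (INR N ^ j)). apply Rle_div_l; [lra|apply T].
    - apply (ex_series_scal (V := R_NormedModule)), ex_series_poly_geom; [apply INR_S_pos|].
      split; [apply Cmod_ge_0|now apply Cmod_nome_lt_1]. }
  rewrite <- CSeries_scal by trivial. apply CSeries_ext. intros l. unfold c.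
  rewrite Nat.mul_comm, Cpow_mult_r, HwN, mult_INR, (Rmult_comm (INR N)).
  rewrite RtoC_div, RtoC_pow, Cpow_inv by (try apply pow_nonzero; trivial; lra).
  simpl. field. split; trivial. now apply Cpow_nz.
Qed.

(** * Passage to the limit in the finite identity *)

Lemma is_derive_lim_seq (f : R -> R) (x l : R) (h : nat -> R) :
  is_derive f x l -> (forall n, h n <> 0) -> is_lim_seq h 0 ->
  is_lim_seq (fun n => (f (x + h n) - f x) / h n) l.
Proof.
  intros Hf Hh Hl. apply is_derive_Reals in Hf. apply is_lim_seq_spec in Hl.
  apply is_lim_seq_spec. intros eps.
  destruct (Hf eps (cond_pos eps)) as [d Hd]. destruct (Hl d) as [N HN].
  exists N. intros n Hn. apply Hd; trivial. specialize (HN n Hn). now rewrite Rminus_0_r in HN.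
Qed.

Lemma Clim_components (u : nat -> C) (l : C) :
  is_lim_seq (fun n => Re (u n)) (Re l) -> is_lim_seq (fun n => Im (u n)) (Im l) -> Clim u l.
Proof.
  intros Hr Hi.
  apply Clim_le with (fun n => Rabs (Re (u n) - Re l) + Rabs (Im (u n) - Im l)).
  - intros n. replace (u n - l)%C
      with (RtoC (Re (u n) - Re l) + Ci * RtoC (Im (u n) - Im l))%C.
    + eapply Rle_trans; [apply Cmod_triangle|]. rewrite Cmod_mult, Cmod_Ci, Rmult_1_l, !Cmod_R. lra.
    + destruct (u n), l. unfold Cminus, Cplus, Cmult, Ci, RtoC, Copp, Re, Im. simpl. f_equal; ring.
  - replace (Finite 0) with (Finite (Rabs (Re l - Re l) + Rabs (Im l - Im l)))
      by (rewrite !Rminus_diag, Rabs_R0; f_equal; ring).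
    apply is_lim_seq_plus'; apply (is_lim_seq_abs _ (Finite _));
      apply is_lim_seq_minus'; trivial; apply is_lim_seq_const.
Qed.

(** The derivative of [Cexp (b t)] at [t = 0], taken in components. With [h = 1/N] and
    [b = 2 PI i t] it says that [N (1 - e(t/N))] tends to [- 2 PI i t]. *)
Lemma Clim_Cexp (b : C) (h : nat -> R) :
  (forall n, h n <> 0) -> is_lim_seq h 0 ->
  Clim (fun n => (/ h n)%R * (1 - Cexp (b * h n)))%C (- b).
Proof.
  intros Hh Hl. destruct b as [x y]. apply Clim_components.
  - apply is_lim_seq_ext with (fun n => - ((exp (x * (0 + h n)) * cos (y * (0 + h n))
      - exp (x * 0) * cos (y * 0)) / h n)).
    + intros n. unfold Cexp, Cmult, Cminus, Cplus, Copp, RtoC, Re, Im. simpl.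
      rewrite !Rmult_0_r, exp_0, cos_0, Rminus_0_r, !Rplus_0_l. field. apply Hh.
    + apply (is_lim_seq_opp _ (Finite x)).
      apply (is_derive_lim_seq (fun t => exp (x * t) * cos (y * t))); trivial.
      auto_derive; trivial. rewrite !Rmult_0_r, exp_0, cos_0, sin_0. ring.
  - apply is_lim_seq_ext with (fun n => - ((exp (x * (0 + h n)) * sin (y * (0 + h n))
      - exp (x * 0) * sin (y * 0)) / h n)).
    + intros n. unfold Cexp, Cmult, Cminus, Cplus, Copp, RtoC, Re, Im. simpl.
      rewrite !Rmult_0_r, exp_0, sin_0, Rminus_0_r, !Rplus_0_l. field. apply Hh.
    + apply (is_lim_seq_opp _ (Finite y)).
      apply (is_derive_lim_seq (fun t => exp (x * t) * sin (y * t))); trivial.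
      auto_derive; trivial. rewrite !Rmult_0_r, exp_0, cos_0, sin_0. ring.
Qed.

Lemma Cmod_one_minus_ge (r : R) (w : C) : Cmod w <= r -> 1 - r <= Cmod (1 - w).
Proof.
  intros H. assert (T := Cmod_triangle (1 - w) w).
  replace (1 - w + w)%C with (RtoC 1) in T by ring. rewrite Cmod_1 in T. lra.
Qed.

(** From [sin y >= y - y^3/6], since [1 - (11/5)^2 / 6 > 1/6]. The range [11/5] is [4 * 11/20], from
    [PI <= 4] and the hypothesis of [lipschitz_term_ge]. *)
Lemma sin_ge_sixth (x : R) : Rabs x <= 11/5 -> Rabs x / 6 <= Rabs (sin x).
Proof.
  assert (H : forall y, 0 <= y <= 11/5 -> y / 6 <= sin y).
  { intros y Hy. destruct (pre_sin_bound y 0 ltac:(lra) ltac:(lra)) as [B _].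
    unfold sin_approx, sin_term in B. simpl in B.
    eapply Rle_trans; [|exact B].
    assert (E : y * (y * y) <= y * (121/25)) by (apply Rmult_le_compat_l; nra).
    lra. }
  intros Hx. destruct (Rle_dec 0 x) as [Hp|Hn].
  - rewrite Rabs_pos_eq in * by trivial. specialize (H x ltac:(lra)). rewrite Rabs_pos_eq; lra.
  - rewrite Rabs_left in * by lra. specialize (H (-x) ltac:(lra)). rewrite sin_neg in H.
    rewrite Rabs_left1; lra.
Qed.

(* [|1 - r e^{2ip}|^2 = (1 - r)^2 + 4 r sin^2 p] *)
Lemma Cmod_one_minus_polar (r0 r p : R) :
  0 <= r0 -> r0 * r0 <= r ->
  2 * r0 * Rabs (sin p) <= Cmod (1 - (r * cos (2 * p), r * sin (2 * p))).
Proof.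
  intros H0 Hr. apply Rsqr_incr_0_var; [|apply Cmod_ge_0].
  unfold Rsqr.
  assert (E := Cmod2_alt (1 - (r * cos (2 * p), r * sin (2 * p)))).
  simpl in E. rewrite Rmult_1_r in E. rewrite E, cos_2a_sin, sin_2a.
  assert (T := sin2_cos2 p). unfold Rsqr in T.
  assert (A : Rabs (sin p) * Rabs (sin p) = sin p * sin p).
  { rewrite <- Rabs_mult. apply Rabs_pos_eq. nra. }
  replace (2 * r0 * Rabs (sin p) * (2 * r0 * Rabs (sin p)))
    with (4 * (r0 * r0) * (Rabs (sin p) * Rabs (sin p))) by ring.
  rewrite A.
  set (s := sin p) in *. set (c := cos p) in *.
  assert (Ec : c * c = 1 - s * s) by lra.
  replace (0 + - (r * (2 * s * c))) with (- (r * (2 * s * c))) by ring.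
  replace ((1 + - (r * (1 - 2 * s * s))) * ((1 + - (r * (1 - 2 * s * s))) * 1) +
    - (r * (2 * s * c)) * (- (r * (2 * s * c)) * 1))
   with ((1 - r) * (1 - r) + 4 * r * (s * s) + 4 * r * r * (s * s) * (c * c - (1 - s * s))) by ring.
  rewrite Ec, Rminus_diag, Rmult_0_r, Rplus_0_r.
  assert (0 <= (1 - r) * (1 - r)) by apply Rle_0_sqr.
  assert (0 <= s * s) by apply Rle_0_sqr. nra.
Qed.

(* Any [D] with [s / (1 + s) <= D] and [exp (- s / 2) * (|x| - |Re tau|) <= D] satisfies
   [term_bound tau * (1 + |x|) <= D]. *)
Definition term_bound (tau : C) : R :=
  let s := 2 * PI * Im tau in
  / (exp (s / 2) + (Rabs (Re tau) + 1) * ((1 + s) / s)).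

Lemma term_bound_pos (tau : C) : 0 < Im tau -> 0 < term_bound tau.
Proof.
  intros H. unfold term_bound. assert (T := PI_RGT_0).
  assert (Hs : 0 < 2 * PI * Im tau) by nra.
  apply Rinv_0_lt_compat. apply Rplus_lt_le_0_compat; [apply exp_pos|].
  apply Rmult_le_pos; [assert (T2 := Rabs_pos (Re tau)); lra|].
  apply Rdiv_le_0_compat; lra.
Qed.

(** Two lower bounds, both uniform in [N]: the modulus of [nome] keeps the term away from [0] ([B0],
    from [exp t >= 1 + t]), and its argument makes the term grow linearly in [|x|] ([B1]). The
    condition with [11/20] keeps the half-angle [p] safely below [PI], where the sine would vanish
    again. *)
Lemma lipschitz_term_ge (tau : C) (x N : R) :
  0 < Im tau -> 1 <= N -> Rabs (Re tau) + Rabs x <= 11/20 * N ->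
  term_bound tau * (1 + Rabs x) <= Cmod (N * (1 - nome ((tau + x) * (/ N)%R))).
Proof.
  intros Hy HN Hx. unfold term_bound. set (s := 2 * PI * Im tau).
  assert (Tpi := PI_RGT_0). assert (Hs : 0 < s) by (unfold s; nra).
  destruct tau as [X y]. unfold Re, Im in *. simpl in *.
  set (D := Cmod _).
  assert (HD : D = N * Cmod (1 - nome ((((X, y) : C) + x) * (/ N)%R))).
  { unfold D. rewrite Cmod_mult, Cmod_R, Rabs_pos_eq; trivial. lra. }
  assert (En : nome ((((X, y) : C) + x) * (/ N)%R) =
    (exp (- (s / N)) * cos (2 * (PI * (X + x) / N)), exp (- (s / N)) * sin (2 * (PI * (X + x) / N)))).
  { replace ((((X, y) : C) + x) * (/ N)%R)%C with (((X + x) / N, y / N) : C).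
    - rewrite nome_pair. unfold s.
      replace (2 * PI * (y / N)) with (2 * PI * y / N) by (field; lra).
      replace (2 * PI * ((X + x) / N)) with (2 * (PI * (X + x) / N)) by (field; lra). reflexivity.
    - unfold Cmult, Cplus, RtoC. simpl. f_equal; field; lra. }
  assert (HsN : 0 < s / N <= s).
  { split; [apply Rdiv_lt_0_compat; lra|]. apply Rle_div_l; [lra|]. nra. }
  assert (B0 : s / (1 + s) <= D).
  { rewrite HD. apply Rle_trans with (N * (1 - exp (- (s / N)))).
    - assert (E1 := exp_ineq1 (s / N) ltac:(lra)). rewrite exp_Ropp.
      assert (E2 : / exp (s / N) <= / (1 + s / N)) by (apply Rinv_le_contravar; lra).
      apply Rle_trans with (N * (1 - / (1 + s / N))); [|apply Rmult_le_compat_l; lra].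
      replace (N * (1 - / (1 + s / N))) with (s / (1 + s / N)).
      + unfold Rdiv at 1 2. apply Rmult_le_compat_l; [lra|]. apply Rinv_le_contravar; lra.
      + assert (N + s <> 0) by lra. field. split; lra.
    - apply Rmult_le_compat_l; [lra|]. apply Cmod_one_minus_ge.
      rewrite Cmod_nome. apply Req_le. f_equal. simpl. unfold s. field. lra. }
  assert (B1 : exp (- (s / 2)) * (Rabs x - Rabs X) <= D).
  { rewrite HD, En. set (p := PI * (X + x) / N).
    assert (Hp : Rabs p = PI * Rabs (X + x) / N).
    { unfold p, Rdiv. rewrite !Rabs_mult, (Rabs_pos_eq PI), (Rabs_pos_eq (/ N)); trivial.
      - apply Rlt_le, Rinv_0_lt_compat. lra.
      - lra. }
    assert (Hp2 : Rabs p <= 11 / 5).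
    { rewrite Hp. apply Rle_div_l; [lra|].
      assert (T1 := Rabs_triang X x). assert (T2 := PI_4). assert (T3 := Rabs_pos (X + x)). nra. }
    apply sin_ge_sixth in Hp2.
    assert (HM := Cmod_one_minus_polar (exp (- (s / 2))) (exp (- (s / N))) p
       ltac:(apply Rlt_le, exp_pos)).
    assert (HX : Rabs x - Rabs X <= Rabs (X + x)).
    { assert (T1 := Rabs_triang (X + x) (- X)). rewrite Rabs_Ropp in T1.
      replace (X + x + - X) with x in T1 by ring. lra. }
    assert (Hr0 := exp_pos (- (s / 2))).
    apply Rle_trans with (N * (2 * exp (- (s / 2)) * Rabs (sin p))).
    - apply Rle_trans with (N * (2 * exp (- (s / 2)) * (Rabs p / 6))).
      + rewrite Hp.
        replace (N * (2 * exp (- (s / 2)) * (PI * Rabs (X + x) / N / 6)))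
          with (exp (- (s / 2)) * (PI / 3 * Rabs (X + x))) by (field; lra).
        apply Rmult_le_compat_l; [lra|].
        assert (T2 := PI2_3_2). assert (T3 := Rabs_pos (X + x)). nra.
      + apply Rmult_le_compat_l; [lra|]. apply Rmult_le_compat_l; lra.
    - apply Rmult_le_compat_l; [lra|]. apply HM.
      rewrite <- exp_plus. destruct (Rle_lt_or_eq_dec (s/N) s) as [L|L]; [lra| |].
      + apply Rlt_le, exp_increasing. lra.
      + apply Req_le. f_equal. lra. }
  clear HD En. clearbody D.
  set (E := exp (s / 2)).
  assert (HE : 0 < E) by apply exp_pos. rewrite exp_Ropp in B1. fold E in B1.
  assert (TX := Rabs_pos X). assert (Tx := Rabs_pos x).
  rewrite Rmult_comm. apply Rle_div_l.
  { apply Rplus_lt_le_0_compat; trivial. apply Rmult_le_pos; [lra|]. apply Rdiv_le_0_compat; lra. }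
  (* Adding [|X| + 1] times [C2] to [C1] eliminates [|X|] and leaves [1 + |x|]. *)
  assert (C1 : Rabs x - Rabs X <= D * E).
  { apply Rmult_le_reg_l with (/ E); [now apply Rinv_0_lt_compat|].
    replace (/ E * (D * E)) with D by (field; lra). exact B1. }
  assert (C2 : 1 <= D * ((1 + s) / s)).
  { apply Rmult_le_reg_l with (s / (1 + s)); [apply Rdiv_lt_0_compat; lra|].
    replace (s / (1 + s) * (D * ((1 + s) / s))) with D by (field; lra). lra. }
  nra.
Qed.

Lemma is_lim_seq_inv_INR (phi : nat -> nat) :
  (forall n, (n <= phi n)%nat) -> is_lim_seq (fun n => / INR (phi n)) 0.
Proof.
  intros H. apply (is_lim_seq_inv _ p_infty); [|discriminate].
  apply is_lim_seq_le_p_loc with INR; [|apply is_lim_seq_INR].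
  exists O. intros n _. now apply le_INR.
Qed.

Lemma asum_lipschitz_rhs (j : nat) (q : C) :
  Cmod q < 1 -> asum (fun l => (INR l ^ j / INR (fact j))%R * q ^ l)%C.
Proof.
  intros Hq. apply asum_le with (fun l => (INR l + 1) ^ j * Cmod q ^ l).
  - intros l. rewrite Cmod_mult, Cmod_R, Cmod_pow.
    assert (T := pos_INR l). assert (F := lt_O_fact j). apply (le_INR 1) in F. simpl in F.
    assert (P := pow_le _ j T).
    apply Rmult_le_compat_r; [apply pow_le, Cmod_ge_0|].
    rewrite Rabs_pos_eq by (apply Rdiv_le_0_compat; lra).
    apply Rle_div_l; [lra|].
    assert (P' : INR l ^ j <= (INR l + 1) ^ j) by (apply pow_incr; lra). nra.
  - apply ex_series_poly_geom; [lra|]. split; [apply Cmod_ge_0|trivial].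
Qed.

(** Of the [k] factors [1/y <= 1] two are kept, enough for comparison with the sum of inverse
    squares. *)
Lemma Cmod_inv_pow_le (u : C) (c y : R) (k : nat) :
  (2 <= k)%nat -> 0 < c -> 1 <= y -> c * y <= Cmod u ->
  Cmod ((/ u) ^ k) <= / c ^ k * (/ y) ^ 2.
Proof.
  intros Hk Hc Hy H. assert (Hu : 0 < Cmod u) by nra.
  rewrite Cmod_pow, Cmod_inv by now apply Cmod_gt_0.
  apply Rle_trans with ((/ c * / y) ^ k).
  - apply pow_incr. split; [now apply Rlt_le, Rinv_0_lt_compat|].
    rewrite <- Rinv_mult. apply Rinv_le_contravar; nra.
  - rewrite Rpow_mult_distr, pow_inv.
    apply Rmult_le_compat_l; [now apply Rlt_le, Rinv_0_lt_compat, pow_lt|].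
    assert (Hy' : 0 < / y <= 1).
    { split; [apply Rinv_0_lt_compat; lra|]. rewrite <- Rinv_1. apply Rinv_le_contravar; lra. }
    replace k with (2 + (k - 2))%nat by lia. rewrite pow_add.
    rewrite <- (Rmult_1_r ((/ y) ^ 2)) at 2. apply Rmult_le_compat_l; [apply pow_le; lra|].
    rewrite <- (pow1 (k - 2)). apply pow_incr. lra.
Qed.

Lemma ex_series_inv_square : ex_series (fun n => (/ INR (S n)) ^ 2).
Proof.
  apply ex_series_incr_1.
  apply (ex_series_le (V := R_CompleteNormedModule)) with (fun n => / INR (S n) - / INR (S (S n))).
  - intros n. change (Rabs ((/ INR (S (S n))) ^ 2) <= / INR (S n) - / INR (S (S n))).
    assert (H := INR_S_pos n). rewrite (S_INR (S n)).
    set (x := INR (S n)) in *.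
    rewrite Rabs_pos_eq by (apply pow_le, Rlt_le, Rinv_0_lt_compat; lra).
    apply Rminus_le.
    replace ((/ (x + 1)) ^ 2 - (/ x - / (x + 1))) with (- / (x * (x + 1) ^ 2)) by (field; lra).
    assert (0 < / (x * (x + 1) ^ 2)); [|lra]. apply Rinv_0_lt_compat. nra.
  - exists 1. change (is_lim_seq (sum_n (fun n => / INR (S n) - / INR (S (S n)))) 1).
    apply is_lim_seq_ext with (fun n => 1 - / INR (S (S n))).
    + intros n. induction n as [|n IH].
      * rewrite sum_O. simpl. field.
      * rewrite sum_Sn, <- IH. unfold plus. simpl. ring.
    + replace (Finite 1) with (Finite (1 - 0)) by (f_equal; ring).
      apply is_lim_seq_minus'; [apply is_lim_seq_const|].
      apply (is_lim_seq_inv_INR (fun n => S (S n))). lia.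
Qed.

(** Same combination as in [lipschitz_term_ge]: the imaginary part gives a constant lower bound, the
    real part growth in [|x|]. *)
Lemma Cmod_add_real_ge (tau : C) (x : R) :
  0 < Im tau -> / (1 + (Rabs (Re tau) + 1) / Im tau) * (1 + Rabs x) <= Cmod (tau + x).
Proof.
  intros Hy. assert (T1 := re_le_Cmod (tau + x)%C).
  assert (T2 := Rmax_Cmod (tau + x)%C).
  assert (T3 := Rmax_r (Rabs (fst (tau + x)%C)) (Rabs (snd (tau + x)%C))).
  destruct tau as [X y]. simpl in *. rewrite Rplus_0_r, (Rabs_pos_eq y) in T2, T3 by lra.
  assert (T4 : Rabs x - Rabs X <= Rabs (X + x)).
  { assert (T := Rabs_triang (X + x) (- X)). rewrite Rabs_Ropp in T.
    replace (X + x + - X) with x in T by ring. lra. }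
  assert (TX := Rabs_pos X).
  set (D := Cmod _) in *.
  assert (HK : 0 <= (Rabs X + 1) / y) by (apply Rdiv_le_0_compat; lra).
  rewrite Rmult_comm. apply Rle_div_l; [lra|].
  assert (HD : 1 <= D / y) by (apply Rle_div_r; [lra|]; rewrite Rmult_1_l; lra).
  replace (D * (1 + (Rabs X + 1) / y)) with (D + D / y * (Rabs X + 1)) by (field; lra).
  change (Rabs (X + x) <= D) in T1.
  assert (1 * (Rabs X + 1) <= D / y * (Rabs X + 1)) by (apply Rmult_le_compat_r; lra).
  lra.
Qed.

Lemma asum_add_real (k : nat) (tau : C) (e : R) :
  (2 <= k)%nat -> 0 < Im tau -> Rabs e = 1 ->
  asum (fun n => / (tau + (e * INR (S n))%R) ^ k)%C.
Proof.
  intros Hk Hy He. set (c := / (1 + (Rabs (Re tau) + 1) / Im tau)).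
  assert (Hc : 0 < c).
  { apply Rinv_0_lt_compat. assert (T := Rabs_pos (Re tau)).
    assert (0 <= (Rabs (Re tau) + 1) / Im tau) by (apply Rdiv_le_0_compat; lra). lra. }
  apply asum_le with (fun n => / c ^ k * (/ INR (S n)) ^ 2).
  - intros n. assert (P := INR_S_pos n).
    assert (Ha : Rabs (e * INR (S n)) = INR (S n)).
    { rewrite Rabs_mult, He, Rmult_1_l. apply Rabs_pos_eq. lra. }
    assert (B := Cmod_add_real_ge tau (e * INR (S n)) Hy). fold c in B. rewrite Ha in B.
    assert (Hnz : (tau + (e * INR (S n))%R)%C <> 0).
    { apply Cmod_gt_0. eapply Rlt_le_trans; [|exact B]. apply Rmult_lt_0_compat; lra. }
    rewrite <- Cpow_inv by trivial. apply Cmod_inv_pow_le; trivial.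
    + rewrite S_INR. assert (T := pos_INR n). lra.
    + eapply Rle_trans; [|exact B]. apply Rmult_le_compat_l; lra.
  - apply (ex_series_scal (V := R_NormedModule)), ex_series_inv_square.
Qed.

Lemma lipschitz (k : nat) (tau : C) :
  (2 <= k)%nat -> 0 < Im tau ->
  (/ tau ^ k + CSeries (fun n => / (tau + INR (S n)) ^ k + / (tau - INR (S n)) ^ k))%C
  = ((- (2 * PI * Ci)) ^ k / INR (fact (k - 1))
     * CSeries (fun d => INR (S d) ^ (k - 1) * nome tau ^ S d))%C.
Proof.
  intros Hk Hy. destruct k as [|j]; [lia|]. replace (S j - 1)%nat with j by lia.
  assert (HPI := PI_RGT_0).
  assert (Hq := Cmod_nome_lt_1 tau Hy).
  set (b := (2 * PI * Ci)%C).
  assert (Hb : b <> 0).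
  { intros E. unfold b, Ci, RtoC, Cmult in E. simpl in E. injection E. lra. }
  assert (Hnz : forall x : R, (tau + x)%C <> 0).
  { intros x E. apply (f_equal Im) in E. destruct tau. simpl in *. lra. }
  (* With [M >= 10 |Re tau|] and [|x| <= M] one gets [|Re tau| + |x| <= 11/10 M <= 11/20 N], as
     [lipschitz_term_ge] demands. *)
  destruct (nfloor_ex (10 * Rabs (Re tau) + 1)) as [m0 Hm0].
  { assert (T := Rabs_pos (Re tau)). lra. }
  set (M := fun i => (S m0 + i)%nat). set (N := fun i => (2 * M i + 1)%nat).
  assert (HN1 : forall i, (1 <= N i)%nat) by (intros; unfold N; lia).
  assert (HN1R : forall i, 1 <= INR (N i)) by (intros; apply (le_INR 1), HN1).
  assert (HNlim : is_lim_seq (fun i => / INR (N i)) 0).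
  { apply is_lim_seq_inv_INR. intros n. unfold N, M. lia. }
  set (g := fun i (x : R) => ((/ (INR (N i) * (1 - nome ((tau + x) * (/ INR (N i))%R)))) ^ S j)%C).
  set (c := term_bound tau). assert (Hc := term_bound_pos tau Hy). fold c in Hc.
  assert (Hg : forall i x, Rabs x <= INR (M i) ->
     Cmod (g i x) <= / c ^ S j * (/ (1 + Rabs x)) ^ 2).
  { intros i x Hx. apply Cmod_inv_pow_le; trivial.
    - assert (T := Rabs_pos x). lra.
    - apply lipschitz_term_ge; trivial.
      unfold N. rewrite plus_INR, mult_INR. simpl INR at 1 3.
      assert (INR (M i) >= 10 * Rabs (Re tau)).
      { unfold M. rewrite plus_INR, S_INR. assert (T := pos_INR i). lra. }
      lra. }
  assert (Hgl : forall x, Clim (fun i => g i x) ((/ (- b * (tau + x))) ^ S j)%C).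
  { intros x. apply Clim_pow, Clim_inv.
    - apply Cmult_neq_0; trivial. intros E. apply Hb.
      replace b with (- - b)%C by ring. rewrite E. ring.
    - intros i. apply Cmult_neq_0.
      + intros E. apply RtoC_inj in E. specialize (HN1R i). lra.
      + apply one_minus_neq_0, Cmod_nome_lt_1.
        replace (Im _) with (Im tau * / INR (N i)).
        * apply Rmult_lt_0_compat; trivial. apply Rinv_0_lt_compat.
          specialize (HN1R i). lra.
        * unfold Im, Cmult, Cplus, RtoC. simpl. ring.
    - replace (- b * (tau + x))%C with (- (b * (tau + x)))%C by ring.
      eapply Clim_ext; [|apply (Clim_Cexp (b * (tau + x))%C (fun i => / INR (N i)))]; trivial.
      + intros i. cbv beta. rewrite Rinv_inv. unfold nome. fold b. now rewrite Cmult_assoc.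
      + intros i. specialize (HN1R i). apply Rinv_neq_0_compat. lra. }
  (* Extension by [0] turns the finite sums into series over a common index set, ready for
     [tannery]; each fixed [n] is below [M i] from some [i] on. *)
  set (f := fun i n => if (n <? M i)%nat then (g i (INR (S n)) + g i (- INR (S n))%R)%C else 0).
  assert (EL : forall i, (g i 0 + CSeries (f i))%C
    = CSeries (fun l => (mchoose j (INR l * INR (N i)) / INR (N i) ^ j)%R * nome tau ^ l)%C).
  { intros i. rewrite <- (lipschitz_finite j (N i) (M i)) by trivial.
    transitivity (csum (fun n => g i (INR n - INR (M i))) (2 * M i + 1)); [|reflexivity].
    rewrite csum_symmetric. f_equal.
    rewrite (CSeries_finite _ (M i)).
    - apply csum_ext. intros n Hn. unfold f. apply Nat.ltb_lt in Hn. now rewrite Hn.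
    - intros n Hn. unfold f. apply Nat.ltb_ge in Hn. now rewrite Hn. }
  assert (LR : Clim (fun i => CSeries (fun l =>
      (mchoose j (INR l * INR (N i)) / INR (N i) ^ j)%R * nome tau ^ l))%C
      (CSeries (fun l => (INR l ^ j / INR (fact j))%R * nome tau ^ l)%C)).
  { apply tannery with (fun l => (INR l + INR (S j)) ^ j * Cmod (nome tau) ^ l).
    - apply ex_series_poly_geom; [apply INR_S_pos|]. split; [apply Cmod_ge_0|trivial].
    - intros i l. rewrite Cmod_mult, Cmod_R, Cmod_pow.
      assert (T := mchoose_scaled j (N i) (INR l) (HN1 i) (pos_INR l)).
      rewrite Rabs_pos_eq by apply T.
      apply Rmult_le_compat_r; [apply pow_le, Cmod_ge_0|apply T].
    - intros l. apply Clim_mult; [|apply Clim_const].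
      apply Clim_components; [|apply is_lim_seq_const].
      exact (mchoose_scaled_lim j (INR l) N HN1 HNlim). }
  assert (LL : Clim (fun i => g i 0 + CSeries (f i))%C
     ((/ (- b * (tau + 0))) ^ S j + CSeries (fun n =>
        (/ (- b * (tau + INR (S n)))) ^ S j + (/ (- b * (tau + (- INR (S n))%R))) ^ S j))%C).
  { apply Clim_plus; [apply Hgl|].
    apply tannery with (fun n => / c ^ S j * (/ INR (S n)) ^ 2 * 2).
    - apply ex_series_scal_r, (ex_series_scal (V := R_NormedModule)), ex_series_inv_square.
    - intros i n.
      assert (P1 : 0 < / c ^ S j) by now apply Rinv_0_lt_compat, pow_lt.
      assert (P2 := INR_S_pos n).
      assert (P3 : 0 <= (/ INR (S n)) ^ 2) by now apply pow_le, Rlt_le, Rinv_0_lt_compat.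
      unfold f. destruct (Nat.ltb_spec n (M i)) as [L|L].
      + eapply Rle_trans; [apply Cmod_triangle|].
        assert (Q : / (1 + INR (S n)) <= / INR (S n)) by (apply Rinv_le_contravar; lra).
        assert (Q' : (/ (1 + INR (S n))) ^ 2 <= (/ INR (S n)) ^ 2).
        { apply pow_incr. split; trivial. apply Rlt_le, Rinv_0_lt_compat. lra. }
        assert (L' : INR (S n) <= INR (M i)) by (apply le_INR; lia).
        assert (B1 := Hg i (INR (S n))). assert (B2 := Hg i (- INR (S n))).
        rewrite Rabs_Ropp in B2. rewrite Rabs_pos_eq in B1, B2 by lra.
        specialize (B1 L'). specialize (B2 L').
        assert (/ c ^ S j * (/ (1 + INR (S n))) ^ 2 <= / c ^ S j * (/ INR (S n)) ^ 2)
          by (apply Rmult_le_compat_l; lra).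
        lra.
      + rewrite Cmod_0. apply Rmult_le_pos; [|lra]. apply Rmult_le_pos; lra.
    - intros n.
      apply (is_lim_seq_ext_loc (fun i => Cmod (g i (INR (S n)) + g i (- INR (S n))%R
        - ((/ (- b * (tau + INR (S n)))) ^ S j + (/ (- b * (tau + (- INR (S n))%R))) ^ S j)))).
      + exists n. intros i Hi. unfold f.
        replace (n <? M i)%nat with true; trivial. symmetry. apply Nat.ltb_lt. unfold M. lia.
      + now apply Clim_plus. }
  assert (E := Clim_unique _ _ _ (Clim_ext _ _ _ EL LL) LR). clear LL LR EL.
  assert (Hbb : (- b)%C <> 0).
  { intros E'. apply Hb. replace b with (- - b)%C by ring. rewrite E'. ring. }
  assert (Ep : forall x : R, ((/ (- b * (tau + x))) ^ S j = / (- b) ^ S j * / (tau + x) ^ S j)%C).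
  { intros x. rewrite Cpow_inv by now apply Cmult_neq_0.
    rewrite Cpow_mult_l. field. split; now apply Cpow_nz. }
  assert (A := asum_lipschitz_rhs j (nome tau) Hq).
  assert (HF : RtoC (INR (fact j)) <> 0).
  { intros E'. apply RtoC_inj in E'. now apply INR_fact_neq_0 in E'. }
  assert (Ef : forall d, ((INR (S d) ^ j / INR (fact j))%R * nome tau ^ S d
    = / INR (fact j) * (INR (S d) ^ j * nome tau ^ S d))%C).
  { intros d. rewrite RtoC_div, RtoC_pow by apply INR_fact_neq_0. field. trivial. }
  assert (A1 : asum (fun d => INR (S d) ^ j * nome tau ^ S d)%C).
  { assert (A' := asum_scal (INR (fact j)) _ (asum_S _ A)). revert A'. apply asum_ext.
    intros d. cbv beta. rewrite Ef. field. trivial. }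
  assert (ER : CSeries (fun l => (INR l ^ j / INR (fact j))%R * nome tau ^ l)%C
    = (/ INR (fact j) * CSeries (fun d => INR (S d) ^ j * nome tau ^ S d))%C).
  { rewrite (CSeries_S _ A), <- CSeries_scal, (CSeries_ext _ _ Ef) by trivial.
    (* The term [l = 0] vanishes because [j = k - 1 >= 1]. *)
    change (INR 0) with 0. rewrite pow_ne_zero by lia. unfold Rdiv. rewrite Rmult_0_l. ring. }
  rewrite ER in E.
  assert (A2 : asum (fun n => / (tau + INR (S n)) ^ S j + / (tau - INR (S n)) ^ S j)%C).
  { apply asum_plus.
    - eapply asum_ext; [|apply (asum_add_real (S j) tau 1 Hk Hy), Rabs_R1].
      intros n. cbv beta. now rewrite Rmult_1_l.
    - eapply asum_ext; [|apply (asum_add_real (S j) tau (-1) Hk Hy)].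
      + intros n. cbv beta. replace (RtoC (-1 * INR (S n))) with (- INR (S n))%C
          by (rewrite <- RtoC_opp; f_equal; ring). reflexivity.
      + rewrite Rabs_left; lra. }
  rewrite (CSeries_ext _ (fun n => / (- b) ^ S j *
     (/ (tau + INR (S n)) ^ S j + / (tau - INR (S n)) ^ S j))%C) in E.
  2:{ intros n. rewrite !Ep, RtoC_opp. unfold Cminus. ring. }
  rewrite (CSeries_scal _ _ A2), Ep, Cplus_0_r in E.
  apply (f_equal (Cmult ((- b) ^ S j))) in E.
  rewrite Cmult_plus_distr_l, !Cmult_assoc, Cinv_r, !Cmult_1_l in E by now apply Cpow_nz.
  rewrite E. field. trivial.
Qed.

(** * Estimates of lattice sums *)

Lemma CSeries_RtoC (a : nat -> R) :
  ex_series a -> CSeries (fun n => RtoC (a n)) = RtoC (Series a).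
Proof.
  intros H. apply CSeries_unique. apply Clim_components.
  - apply (is_lim_seq_ext (rsum a)); [|now apply is_lim_seq_rsum].
    intros n. induction n as [|n IH]; trivial.
    change (rsum a n + a n = Re (csum (fun n => RtoC (a n)) n) + a n). now rewrite <- IH.
  - apply (is_lim_seq_ext (fun _ => 0)); [|apply is_lim_seq_const].
    intros n. induction n as [|n IH]; trivial.
    change (0 = Im (csum (fun n => RtoC (a n)) n) + 0). rewrite <- IH. ring.
Qed.

(* [(n + 1)^(-k/2)] *)
Definition hpow (k n : nat) : R := (/ sqrt (INR (S n))) ^ k.

Lemma sqrt_INR_S_ge_1 (n : nat) : 1 <= sqrt (INR (S n)).
Proof. rewrite <- sqrt_1 at 1. apply sqrt_le_1_alt, (le_INR 1). lia. Qed.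

Lemma hpow_pos (k n : nat) : 0 < hpow k n.
Proof.
  apply pow_lt, Rinv_0_lt_compat. assert (T := sqrt_INR_S_ge_1 n). lra.
Qed.

Lemma hpow_0 (k : nat) : hpow k 0 = 1.
Proof. unfold hpow. simpl INR. now rewrite sqrt_1, Rinv_1, pow1. Qed.

Lemma hpow_4 (n : nat) : hpow 4 n = (/ INR (S n)) ^ 2.
Proof.
  unfold hpow. rewrite (pow_mult _ 2 2 : (/ _) ^ 4 = _).
  f_equal. rewrite pow_inv. f_equal. apply pow2_sqrt, pos_INR.
Qed.

Lemma hpow_add_le (k j n : nat) (c : R) :
  0 < c -> c <= sqrt (INR (S n)) -> hpow (k + j) n <= hpow k n * (/ c) ^ j.
Proof.
  intros Hc H. unfold hpow. rewrite pow_add.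
  apply Rmult_le_compat_l; [apply Rlt_le, hpow_pos|].
  apply pow_incr. split; [apply Rlt_le, Rinv_0_lt_compat; lra|]. now apply Rinv_le_contravar.
Qed.

Lemma ex_series_hpow (k : nat) : (4 <= k)%nat -> ex_series (hpow k).
Proof.
  intros Hk. apply (ex_series_le (V := R_CompleteNormedModule)) with (2 := ex_series_inv_square).
  intros n. change (Rabs (hpow k n) <= (/ INR (S n)) ^ 2).
  rewrite Rabs_pos_eq by apply Rlt_le, hpow_pos. rewrite <- hpow_4.
  replace k with (4 + (k - 4))%nat by lia.
  eapply Rle_trans; [apply (hpow_add_le _ _ _ 1); [lra|apply sqrt_INR_S_ge_1]|].
  rewrite Rinv_1, pow1. lra.
Qed.

(** Telescoping at half-integers: [1/(n + 7/2) - 1/(n + 9/2)] is [1/((n + 4)^2 - 1/4)], slightly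
    more than [1/(n + 4)^2]. *)
Lemma Series_inv_square_tail_le :
  Series (fun n => (/ INR (S (3 + n))) ^ 2) <= 2 / 7.
Proof.
  set (u := fun n => / (INR n + 7 / 2)).
  assert (Hu : is_series (fun n => u n - u (S n)) (2 / 7)).
  { change (is_lim_seq (sum_n (fun n => u n - u (S n))) (2 / 7)).
    apply is_lim_seq_ext with (fun n => 2 / 7 - u (S n)).
    - intros n. induction n as [|n IH].
      + rewrite sum_O. unfold u. simpl. field.
      + rewrite sum_Sn, <- IH. unfold plus. simpl. ring.
    - replace (Finite (2 / 7)) with (Finite (2 / 7 - 0)) by (f_equal; ring).
      apply is_lim_seq_minus'; [apply is_lim_seq_const|].
      apply (is_lim_seq_incr_1 u), (is_lim_seq_inv _ p_infty); [|discriminate].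
      apply is_lim_seq_plus with p_infty (Finite (7 / 2));
        [apply is_lim_seq_INR|apply is_lim_seq_const|reflexivity]. }
  rewrite <- (is_series_unique _ _ Hu). apply Series_le; [|now exists (2 / 7)].
  intros n. assert (T := pos_INR n). rewrite S_INR, plus_INR. simpl (INR 3). unfold u.
  rewrite S_INR. set (x := INR n) in *. split.
  - apply pow_le, Rlt_le, Rinv_0_lt_compat. lra.
  - apply Rminus_le.
    replace ((/ (1 + 1 + 1 + x + 1)) ^ 2 - (/ (x + 7 / 2) - / (x + 1 + 7 / 2)))
      with (- / (4 * (x + 4) ^ 2 * ((x + 7 / 2) * (x + 9 / 2)))) by (field; lra).
    apply Rlt_le, Ropp_lt_gt_0_contravar, Rinv_0_lt_compat. repeat apply Rmult_lt_0_compat; try apply pow_lt; lra.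
Qed.

(** Replaces square roots by rational inequalities in the numerical estimates. *)
Lemma inv_sqrt_le (x c : R) : 0 < c -> 1 <= x * (c * c) -> / sqrt x <= c.
Proof.
  intros Hc H. assert (Hx : 0 < x) by nra.
  rewrite <- (Rinv_inv c). apply Rinv_le_contravar; [now apply Rinv_0_lt_compat|].
  rewrite <- (sqrt_square (/ c)) by now apply Rlt_le, Rinv_0_lt_compat.
  apply sqrt_le_1_alt. apply Rmult_le_reg_r with (c * c); [nra|].
  replace (/ c * / c * (c * c)) with 1 by (field; lra). exact H.
Qed.

Lemma pow_le_pow (c : R) (m n : nat) : 0 <= c <= 1 -> (m <= n)%nat -> c ^ n <= c ^ m.
Proof.
  intros Hc Hm. replace n with (m + (n - m))%nat by lia. rewrite pow_add.
  rewrite <- (Rmult_1_r (c ^ m)) at 2. apply Rmult_le_compat_l; [now apply pow_le|].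
  rewrite <- (pow1 (n - m)). now apply pow_incr.
Qed.

(** The decimals lie just above [1 / sqrt 2] and [1 / sqrt 3]. From [m = 4] on, [sqrt m >= 2], so
    all factors beyond the fourth are at most [1/2] and the rest is the tail of the inverse squares.
    Every term decreases in [k], so [k0] stands for all larger weights. *)
Lemma Series_hpow_le (k0 k : nat) :
  (4 <= k0)%nat -> (k0 <= k)%nat ->
  Series (hpow k) <= 1 + (7072 / 10000) ^ k0 + (5774 / 10000) ^ k0 + 2 / 7 * (1 / 2) ^ (k0 - 4).
Proof.
  intros Hk0 Hk. assert (He := ex_series_hpow k ltac:(lia)).
  rewrite (Series_incr_n (hpow k) 3) by (trivial; lia). simpl pred.
  cbn [sum_f_R0]. rewrite hpow_0.
  assert (B : forall n c, 0 < c <= 1 -> 1 <= INR (S n) * (c * c) -> hpow k n <= c ^ k0).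
  { intros n c Hc H. apply Rle_trans with (c ^ k); [|apply pow_le_pow; trivial; lra].
    apply pow_incr. split; [|now apply inv_sqrt_le].
    apply Rlt_le, Rinv_0_lt_compat. assert (T := sqrt_INR_S_ge_1 n). lra. }
  assert (B1 := B 1%nat (7072 / 10000) ltac:(lra) ltac:(simpl; lra)).
  assert (B2 := B 2%nat (5774 / 10000) ltac:(lra) ltac:(simpl; lra)).
  assert (B3 : Series (fun n => hpow k (3 + n)) <= (1 / 2) ^ (k0 - 4) * (2 / 7)).
  { eapply Rle_trans; [|apply Rmult_le_compat_l; [apply pow_le; lra|apply Series_inv_square_tail_le]].
    rewrite <- Series_scal_l. apply Series_le.
    - intros n. split; [apply Rlt_le, hpow_pos|].
      rewrite <- hpow_4, Rmult_comm. replace k with (4 + (k - 4))%nat by lia.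
      eapply Rle_trans; [apply (hpow_add_le _ _ _ 2); [lra|]|].
      + rewrite <- (sqrt_square 2) by lra. apply sqrt_le_1_alt.
        rewrite S_INR, plus_INR. simpl (INR 3). assert (T := pos_INR n). lra.
      + apply Rmult_le_compat_l; [apply Rlt_le, hpow_pos|].
        replace (/ 2) with (1 / 2) by field. apply pow_le_pow; [lra|lia].
    - apply (ex_series_scal (V := R_NormedModule)).
      apply (ex_series_incr_n (fun n => (/ INR (S n)) ^ 2) 3), ex_series_inv_square. }
  lra.
Qed.

Lemma double_series_le (f : nat -> nat -> C) (a b : nat -> R) :
  ex_series a -> ex_series b -> (forall m n, Cmod (f m n) <= a m * b n) ->
  Cmod (CSeries (fun m => CSeries (f m))) <= Series a * Series b.
Proof.
  intros Ha Hb H. rewrite <- Series_scal_r. apply Cmod_CSeries_le.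
  - intros m. rewrite <- Series_scal_l. apply Cmod_CSeries_le; trivial.
    now apply (ex_series_scal (V := R_NormedModule)).
  - now apply ex_series_scal_r.
Qed.

(** The majorants sum to the square of [Series a], to which the removed corner contributes
    [a 0 * a 0 = 1]. The bound with [t] gives convergence, the one with [s] the estimate. *)
Lemma double_series_minus_first_le (f : nat -> nat -> C) (a : nat -> R) (s t : R) :
  ex_series a -> a O = 1 ->
  (forall m n, Cmod (f m n) <= t * (a m * a n)) ->
  (forall m n, (m, n) <> (O, O) -> Cmod (f m n) <= s * (a m * a n)) ->
  Cmod (CSeries (fun m => CSeries (f m)) - f O O) <= s * (Series a * Series a - 1).
Proof.
  intros Ha Ha0 Ht Hs.
  assert (Hta : forall c, ex_series (fun n => c * a n))
    by (intros c; now apply (ex_series_scal (V := R_NormedModule))).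
  assert (Hf : forall m n, Cmod (f m n) <= t * a m * a n)
    by (intros m n; rewrite Rmult_assoc; apply Ht).
  assert (Ha1 : ex_series (fun n => a (S n))) by now apply ex_series_incr_1 in Ha.
  assert (Hsa1 : ex_series (fun n => s * a (S n)))
    by now apply (ex_series_scal (V := R_NormedModule)).
  rewrite (CSeries_S (fun m => CSeries (f m))) by exact (asum_CSeries f _ _ Hf (Hta t) Ha).
  rewrite (CSeries_S (f O)) by exact (asum_prod f _ _ Hf Ha O).
  replace (f O O + CSeries (fun n => f O (S n)) + CSeries (fun n => CSeries (f (S n))) - f O O)%C
    with (CSeries (fun n => f O (S n)) + CSeries (fun n => CSeries (f (S n))))%C by ring.
  eapply Rle_trans; [apply Cmod_triangle|].
  assert (E := Series_incr_1 a Ha). rewrite Ha0 in E.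
  apply Rle_trans with (Series (fun n => s * a (S n)) + Series (fun n => s * a (S n)) * Series a).
  - apply Rplus_le_compat.
    + apply Cmod_CSeries_le; trivial. intros n.
      replace (s * a (S n)) with (s * (a O * a (S n))) by (rewrite Ha0; ring).
      apply Hs. discriminate.
    + apply (double_series_le (fun m => f (S m))); trivial.
      intros m n. rewrite Rmult_assoc. apply Hs. discriminate.
  - rewrite Series_scal_l. apply Req_le.
    replace (Series (fun n => a (S n))) with (Series a - 1) by lra. ring.
Qed.

(** A lower bound for [|w|^2] by a multiple of the product of the indices separates the variables,
    at the price of half-integral exponents. *)
Lemma Cmod_inv_pow_sqrt_le (k m n : nat) (w : C) (c : R) :
  0 < c -> c * c * (INR (S m) * INR (S n)) <= Cmod w ^ 2 ->
  Cmod (/ w ^ k) <= (/ c) ^ k * (hpow k m * hpow k n).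
Proof.
  intros Hc H. assert (Pm := INR_S_pos m). assert (Pn := INR_S_pos n).
  assert (Sm := sqrt_INR_S_ge_1 m). assert (Sn := sqrt_INR_S_ge_1 n).
  assert (Hcm : 0 < c * (sqrt (INR (S m)) * sqrt (INR (S n)))).
  { apply Rmult_lt_0_compat; trivial. nra. }
  assert (L : c * (sqrt (INR (S m)) * sqrt (INR (S n))) <= Cmod w).
  { apply Rsqr_incr_0_var; [|apply Cmod_ge_0].
    unfold Rsqr. simpl in H. rewrite Rmult_1_r in H.
    eapply Rle_trans; [|exact H]. apply Req_le.
    assert (Em := sqrt_sqrt (INR (S m)) ltac:(lra)).
    assert (En := sqrt_sqrt (INR (S n)) ltac:(lra)).
    transitivity (c * c * ((sqrt (INR (S m)) * sqrt (INR (S m))) * (sqrt (INR (S n)) * sqrt (INR (S n)))));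
      [ring|now rewrite Em, En]. }
  assert (Hw : w <> 0) by (apply Cmod_gt_0; lra).
  unfold hpow. rewrite <- !Rpow_mult_distr, <- Cpow_inv, Cmod_pow, Cmod_inv by trivial.
  apply pow_incr. split; [apply Rlt_le, Rinv_0_lt_compat; lra|].
  rewrite <- !Rinv_mult. now apply Rinv_le_contravar.
Qed.

(** * The lattice expansion of the Eisenstein series *)

Lemma Cmod2_lattice (z : C) (m n : R) :
  Cmod (m * z + n) ^ 2 = m * m * Cmod z ^ 2 + 2 * Re z * (m * n) + n * n.
Proof.
  rewrite !Cmod2_alt. destruct z as [x y]. simpl. ring.
Qed.

(* [e = 1] and [e = -1] give the parts [n > 0] and [n < 0] of the lattice sum. *)
Definition lattice_term (k : nat) (z : C) (e : R) (m n : nat) : C :=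
  (/ (INR (S m) * z + (e * INR (S n))%R) ^ k)%C.

Definition lattice_sum (k : nat) (z : C) (e : R) : C :=
  CSeries (fun m => CSeries (lattice_term k z e m)).

(** [(p |z| - q)^2 >= 0] bounds the square terms below by [2 |z| p q], and the mixed term loses at
    most [p q] because [|2 Re z| <= 1]. *)
Lemma Cmod2_lattice_ge (z : C) (e : R) (m n : nat) :
  1 <= Cmod z -> - (1 / 2) <= Re z <= 1 / 2 -> e * e = 1 ->
  (2 * Cmod z - 1) * (INR (S m) * INR (S n)) <= Cmod (INR (S m) * z + (e * INR (S n))%R) ^ 2.
Proof.
  intros Hz Hx He. rewrite Cmod2_lattice.
  assert (Pm := INR_S_pos m). assert (Pn := INR_S_pos n).
  set (p := INR (S m)) in *. set (q := INR (S n)) in *. set (r := Cmod z) in *.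
  assert (0 < p * q) by now apply Rmult_lt_0_compat.
  assert (He' : -1 <= e <= 1) by nra.
  assert (Hex : - (1 / 2) <= e * Re z <= 1 / 2) by nra.
  replace (2 * Re z * (p * (e * q))) with (2 * (e * Re z) * (p * q)) by ring.
  replace (e * q * (e * q)) with (q * q) by (transitivity (e * e * (q * q)); [rewrite He|]; ring).
  assert (0 <= (p * r - q) * (p * r - q)) by apply Rle_0_sqr. nra.
Qed.

Lemma lattice_term_le (k : nat) (z : C) (e : R) (m n : nat) :
  1 <= Cmod z -> - (1 / 2) <= Re z <= 1 / 2 -> e * e = 1 ->
  Cmod (lattice_term k z e m n) <= (/ sqrt (2 * Cmod z - 1)) ^ k * (hpow k m * hpow k n).
Proof.
  intros Hz Hx He. apply Cmod_inv_pow_sqrt_le; [apply sqrt_lt_R0; lra|].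
  rewrite sqrt_sqrt by lra. now apply Cmod2_lattice_ge.
Qed.

Lemma zeta_ge_1 (k : nat) : (2 <= k)%nat -> ex_series (fun n => / INR (S n) ^ k) /\ 1 <= zeta k.
Proof.
  intros Hk. assert (He : ex_series (fun n => / INR (S n) ^ k)).
  { apply (ex_series_le (V := R_CompleteNormedModule)) with (2 := ex_series_inv_square).
    intros n. assert (P := INR_S_pos n).
    change (Rabs (/ INR (S n) ^ k) <= (/ INR (S n)) ^ 2).
    rewrite <- pow_inv. rewrite Rabs_pos_eq by now apply pow_le, Rlt_le, Rinv_0_lt_compat.
    apply pow_le_pow; trivial. split; [now apply Rlt_le, Rinv_0_lt_compat|].
    rewrite <- Rinv_1. apply Rinv_le_contravar; [lra|]. apply (le_INR 1). lia. }
  split; trivial. unfold zeta. rewrite Series_incr_1 by trivial.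
  assert (T : 0 <= Series (fun n => / INR (S (S n)) ^ k)).
  { apply Series_ge_0; [|now apply ex_series_incr_1 in He].
    intros n. apply Rlt_le, Rinv_0_lt_compat, pow_lt, INR_S_pos. }
  simpl (INR 1). rewrite pow1, Rinv_1. lra.
Qed.

Lemma asum_lattice (k : nat) (z : C) (e : R) :
  (4 <= k)%nat -> 1 <= Cmod z -> - (1 / 2) <= Re z <= 1 / 2 -> e * e = 1 ->
  (forall m, asum (lattice_term k z e m)) /\ asum (fun m => CSeries (lattice_term k z e m)).
Proof.
  intros Hk Hz Hx He. set (c := (/ sqrt (2 * Cmod z - 1)) ^ k).
  assert (Hs := ex_series_hpow k Hk).
  assert (H : forall m n, Cmod (lattice_term k z e m n) <= c * hpow k m * hpow k n).
  { intros m n. rewrite Rmult_assoc. now apply lattice_term_le. }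
  split.
  - exact (asum_prod _ _ _ H Hs).
  - apply (asum_CSeries _ _ _ H); trivial. now apply (ex_series_scal (V := R_NormedModule)).
Qed.

(** After [lambert_series], Lipschitz' formula at [m z] turns the [m]-th summand of the q-series
    into the [m]-th row of the lattice; the entries with [n = 0] add up to [zeta k / z^k]. *)
Lemma eisenstein_lattice (k : nat) (z : C) :
  (4 <= k)%nat -> 0 < Im z -> 1 <= Cmod z -> - (1 / 2) <= Re z <= 1 / 2 ->
  (zeta k * eisenstein k z
   = zeta k + zeta k * / z ^ k + lattice_sum k z 1 + lattice_sum k z (-1))%C.
Proof.
  intros Hk Hy Hz Hx.
  destruct (zeta_ge_1 k ltac:(lia)) as [Hze Hz1].
  assert (Hq := Cmod_nome_lt_1 z Hy).
  assert (Hz0 : z <> 0) by (apply Cmod_gt_0; lra).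
  destruct (asum_lattice k z 1 Hk Hz Hx ltac:(ring)) as [A1 A1'].
  destruct (asum_lattice k z (-1) Hk Hz Hx ltac:(ring)) as [A2 A2'].
  unfold eisenstein. rewrite lambert_series by trivial.
  set (T := fun m => (/ (INR (S m) * z) ^ k
     + (CSeries (lattice_term k z 1 m) + CSeries (lattice_term k z (-1) m)))%C).
  set (c := ((- (2 * PI * Ci)) ^ k / INR (fact (k - 1)))%C).
  set (V := fun m => CSeries (fun d => INR (S d) ^ (k - 1) * (nome z ^ S m) ^ S d)%C).
  assert (HF : RtoC (INR (fact (k - 1))) <> 0).
  { intros E. apply RtoC_inj in E. now apply INR_fact_neq_0 in E. }
  assert (Hc : c <> 0).
  { unfold c. apply Cmult_neq_0.
    - apply Cpow_nz. intros E. apply (f_equal Im) in E. revert E.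
      unfold Ci, RtoC, Cmult, Copp, Im. simpl. assert (TP := PI_RGT_0). lra.
    - intros E. apply (f_equal (Cmult (INR (fact (k - 1))))) in E. rewrite Cinv_r in E by trivial.
      rewrite Cmult_0_r in E. apply RtoC_inj in E. lra. }
  assert (EV : forall m, (c * V m)%C = T m).
  { intros m. unfold V, T. rewrite <- nome_mult_INR. unfold c.
    rewrite <- lipschitz; [|lia|].
    - f_equal. rewrite <- CSeries_plus by trivial. apply CSeries_ext. intros n.
      unfold lattice_term. rewrite Rmult_1_l.
      replace (RtoC (-1 * INR (S n))) with (- INR (S n))%C by (rewrite <- RtoC_opp; f_equal; ring).
      reflexivity.
    - replace (Im _) with (INR (S m) * Im z).
      + apply Rmult_lt_0_compat; [apply INR_S_pos|trivial].
      + unfold Im, Cmult, RtoC. cbn [fst snd]. ring. }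
  assert (E0 : forall m, (/ (INR (S m) * z) ^ k)%C = (/ z ^ k * RtoC (/ INR (S m) ^ k))%C).
  { intros m. assert (P := INR_S_pos m).
    assert (INR (S m) ^ k <> 0) by (apply pow_nonzero; lra).
    rewrite Cpow_mult_l, RtoC_inv, RtoC_pow by trivial. field.
    split; apply Cpow_nz; trivial. intros E. apply RtoC_inj in E. lra. }
  assert (AZ : asum (fun m => RtoC (/ INR (S m) ^ k))).
  { apply asum_le with (fun m => / INR (S m) ^ k); trivial. intros m.
    rewrite Cmod_R, Rabs_pos_eq; [lra|]. apply Rlt_le, Rinv_0_lt_compat, pow_lt, INR_S_pos. }
  assert (A0 : asum (fun m => (/ (INR (S m) * z) ^ k)%C)).
  { eapply asum_ext; [intros m; symmetry; apply E0|]. now apply asum_scal. }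
  assert (AT : asum T) by (apply asum_plus; trivial; now apply asum_plus).
  (* Convergence on the q-side is inherited from the lattice side by dividing by the nonzero
     constant [c]. *)
  assert (AV : asum V).
  { eapply asum_ext; [|apply (asum_scal (/ c) _ AT)]. intros m. cbv beta.
    rewrite <- EV. field. trivial. }
  assert (ES : (c * CSeries V = CSeries T)%C).
  { rewrite <- CSeries_scal by trivial. now apply CSeries_ext. }
  assert (ET : CSeries T = (zeta k * / z ^ k + (lattice_sum k z 1 + lattice_sum k z (-1)))%C).
  { unfold T. rewrite CSeries_plus, CSeries_plus; trivial; [|now apply asum_plus].
    f_equal. rewrite (CSeries_ext _ _ E0), CSeries_scal, CSeries_RtoC by trivial.
    apply Cmult_comm. }
  fold V. unfold eis_coef.
  assert (Hzk : RtoC (zeta k) <> 0) by (intros E; apply RtoC_inj in E; lra).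
  transitivity (zeta k + c * CSeries V)%C.
  - unfold c. field. split; trivial.
  - rewrite ES, ET. ring.
Qed.

(** * Zeros on the unit circle *)

Lemma Cconj_RtoC (x : R) : Cconj x = x.
Proof. unfold Cconj, RtoC. simpl. now rewrite Ropp_0. Qed.

(** Conjugating a term gives, up to the factor [(e z)^k], the term with [m] and [n] exchanged
    ([Ep]); [fubini] undoes the transposition. *)
Lemma lattice_sum_conj (k : nat) (z : C) (e : R) :
  (4 <= k)%nat -> 0 < Im z -> Cmod z = 1 -> - (1 / 2) <= Re z <= 1 / 2 -> e * e = 1 ->
  Cconj (lattice_sum k z e) = (e ^ k * z ^ k * lattice_sum k z e)%C.
Proof.
  intros Hk Hy Hz Hx He. assert (Hz' : 1 <= Cmod z) by lra.
  destruct (asum_lattice k z e Hk Hz' Hx He) as [A A'].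
  assert (Hz0 : z <> 0) by (apply Cmod_gt_0; lra).
  assert (Hcj : (z * Cconj z = 1)%C) by (rewrite <- Cmod2_conj, Hz; f_equal; ring).
  assert (HeC : (e * e = 1)%C) by (rewrite <- RtoC_mult, He; reflexivity).
  assert (Hnz : forall m n, (INR (S m) * z + (e * INR (S n))%R)%C <> 0).
  { intros m n E. apply (f_equal Im) in E. destruct z as [x y]. revert E.
    unfold Im, Cmult, Cplus, RtoC. cbn [fst snd]. cbn [Im snd] in Hy.
    assert (P := Rmult_lt_0_compat _ _ (INR_S_pos m) Hy). intros E. lra. }
  assert (Ep : forall m n, Cconj (lattice_term k z e m n)
      = (e ^ k * z ^ k * lattice_term k z e n m)%C).
  { intros m n. unfold lattice_term.
    rewrite Cinv_conj by now apply Cpow_nz.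
    rewrite Cpow_conj, Cplus_conj, Cmult_conj, !Cconj_RtoC.
    replace (INR (S m) * Cconj z + (e * INR (S n))%R)%C
      with (e * Cconj z * (INR (S n) * z + (e * INR (S m))%R))%C.
    - assert (Hez : (e * z * (e * Cconj z) = 1)%C).
      { transitivity (e * e * (z * Cconj z))%C; [ring|]. rewrite Hcj, HeC. ring. }
      assert (Hezk : ((e * z) ^ k * (e * Cconj z) ^ k = 1)%C)
        by (rewrite <- Cpow_mult_l, Hez; apply Cpow_1_l).
      rewrite (Cpow_mult_l (e * Cconj z)), <- (Cpow_mult_l e z).
      set (u := ((e * Cconj z) ^ k)%C) in *. set (v := ((e * z) ^ k)%C) in *.
      assert (Hu : u <> 0).
      { intros E. rewrite E, Cmult_0_r in Hezk. apply RtoC_inj in Hezk. lra. }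
      assert (Hv : v = (/ u)%C).
      { transitivity (v * u * / u)%C; [field; trivial|]. rewrite Hezk. ring. }
      rewrite Hv. field. split; trivial. now apply Cpow_nz.
    - rewrite !RtoC_mult.
      transitivity (e * INR (S n) * (z * Cconj z) + e * e * (INR (S m) * Cconj z))%C; [ring|].
      rewrite Hcj, HeC. ring. }
  unfold lattice_sum at 1. rewrite <- CSeries_conj by trivial.
  transitivity (CSeries (fun m => CSeries (fun n => e ^ k * z ^ k * lattice_term k z e n m))%C).
  { apply CSeries_ext. intros m. rewrite <- CSeries_conj by trivial.
    apply CSeries_ext. intros n. apply Ep. }
  set (c := (/ sqrt (2 * Cmod z - 1)) ^ k).
  assert (Hs := ex_series_hpow k Hk).
  assert (Hc : 0 <= c).
  { apply pow_le, Rlt_le, Rinv_0_lt_compat, sqrt_lt_R0. lra. }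
  assert (H : forall m n, Cmod (lattice_term k z e m n) <= c * hpow k m * hpow k n).
  { intros m n. rewrite Rmult_assoc. now apply lattice_term_le. }
  assert (Hcs : ex_series (fun n => c * hpow k n)) by now apply (ex_series_scal (V := R_NormedModule)).
  unfold lattice_sum. rewrite (fubini (lattice_term k z e) _ _ H); trivial.
  - rewrite <- CSeries_scal.
    + apply CSeries_ext. intros m. rewrite <- CSeries_scal; trivial.
      apply asum_le with (fun n => c * hpow k n * hpow k m); [intros; apply H|].
      now apply ex_series_scal_r.
    + apply (asum_CSeries (fun m n => lattice_term k z e n m) (hpow k) (fun n => c * hpow k n)); trivial.
      intros m n. rewrite Rmult_comm. apply H.
  - intros n. apply Rmult_le_pos; trivial. apply Rlt_le, hpow_pos.
  - intros n. apply Rlt_le, hpow_pos.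
Qed.

Lemma Series_hpow_ge_1 (k : nat) : (4 <= k)%nat -> 1 <= Series (hpow k).
Proof.
  intros Hk. assert (He := ex_series_hpow k Hk).
  rewrite Series_incr_1, hpow_0 by trivial.
  assert (0 <= Series (fun n => hpow k (S n))); [|lra].
  apply Series_ge_0; [intros; apply Rlt_le, hpow_pos|now apply ex_series_incr_1 in He].
Qed.

Lemma Cmod_inv_pow_le_inv (k : nat) (w : C) (c : R) :
  0 < c -> c <= Cmod w -> Cmod (/ w ^ k) <= (/ c) ^ k.
Proof.
  intros Hc H. assert (Hw : w <> 0) by (apply Cmod_gt_0; lra).
  rewrite <- Cpow_inv, Cmod_pow, Cmod_inv by trivial.
  apply pow_incr. split; [apply Rlt_le, Rinv_0_lt_compat; lra|]. now apply Rinv_le_contravar.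
Qed.

Lemma zero_Cmod_neq_1 (k : nat) (z : C) :
  Nat.Odd k -> (5 <= k)%nat -> 0 < Im z -> - (1 / 2) <= Re z <= 1 / 2 ->
  eisenstein k z = 0 -> Cmod z <> 1.
Proof.
  intros Hodd Hk Hy Hx HE Hz.
  assert (Hz0 : z <> 0) by (apply Cmod_gt_0; lra).
  assert (E := eisenstein_lattice k z ltac:(lia) Hy ltac:(lra) Hx).
  rewrite HE, Cmult_0_r in E.
  assert (C1 := lattice_sum_conj k z 1 ltac:(lia) Hy Hz Hx ltac:(ring)).
  assert (C2 := lattice_sum_conj k z (-1) ltac:(lia) Hy Hz Hx ltac:(ring)).
  rewrite <- RtoC_pow, pow1, Cmult_1_l in C1.
  (* Oddness gives [P] and [N] opposite signs under conjugation; with equal signs the conjugate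
     equation would only be a multiple of the original one. *)
  replace ((-1) ^ k)%C with (RtoC (-1)) in C2.
  2:{ destruct Hodd as [j ->]. rewrite <- RtoC_pow. f_equal.
      rewrite pow_add, pow_mult. replace ((-1) ^ 2) with 1 by ring. rewrite pow1. ring. }
  assert (Hzk := Cpow_nz z k Hz0).
  assert (Hcj : (Cconj (/ z ^ k) = z ^ k)%C).
  { assert (Hcz : (z * Cconj z = 1)%C) by (rewrite <- Cmod2_conj, Hz; f_equal; ring).
    rewrite Cinv_conj, Cpow_conj by trivial.
    assert (Hp : (z ^ k * Cconj z ^ k = 1)%C) by (rewrite <- Cpow_mult_l, Hcz; apply Cpow_1_l).
    assert (Hn : (Cconj z ^ k)%C <> 0).
    { intros E'. rewrite E', Cmult_0_r in Hp. apply RtoC_inj in Hp. lra. }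
    transitivity (z ^ k * Cconj z ^ k * / Cconj z ^ k)%C; [rewrite Hp; ring|field; trivial]. }
  assert (E' := f_equal Cconj E).
  rewrite !Cplus_conj, Cmult_conj, !Cconj_RtoC, Hcj, C1, C2 in E'.
  set (P := lattice_sum k z 1) in *. set (N := lattice_sum k z (-1)) in *.
  (* Subtracting the conjugate equation from [z^k] times the original one leaves [2 z^k N]. *)
  assert (HN : N = 0).
  { assert (E2 : (2 * z ^ k * N = 0)%C).
    { transitivity (z ^ k * (zeta k + zeta k * / z ^ k + P + N)
        - (zeta k + zeta k * z ^ k + z ^ k * P + RtoC (-1) * z ^ k * N))%C.
      - replace (RtoC (-1)) with (- (1))%C by (rewrite <- RtoC_opp; f_equal).
        field. trivial.
      - rewrite <- E, <- E'. ring. }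
    destruct (Ceq_dec N 0) as [Z|Z]; trivial. exfalso.
    refine (Cmult_neq_0 _ _ _ Z E2). apply Cmult_neq_0; trivial.
    intros H. apply RtoC_inj in H. lra. }
  set (A := Series (hpow k)).
  assert (HA1 := Series_hpow_ge_1 k ltac:(lia)). fold A in HA1.
  assert (HA := Series_hpow_le 5 k ltac:(lia) Hk). fold A in HA. simpl in HA.
  set (w := (INR 1 * z + (-1 * INR 1)%R)%C).
  assert (Hw2 : Cmod w ^ 2 = 2 - 2 * Re z).
  { unfold w. rewrite Cmod2_lattice, Hz. simpl. ring. }
  assert (Hw : 0 < Cmod w).
  { destruct (Cmod_ge_0 w) as [H|H]; trivial. rewrite <- H in Hw2. simpl in Hw2. lra. }
  assert (D := double_series_minus_first_le (lattice_term k z (-1)) (hpow k)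
    ((/ Cmod w) ^ k) ((/ Cmod w) ^ k) (ex_series_hpow k ltac:(lia)) (hpow_0 k)).
  assert (B : forall m n, Cmod (lattice_term k z (-1) m n) <= (/ Cmod w) ^ k * (hpow k m * hpow k n)).
  { intros m n. apply Cmod_inv_pow_sqrt_le; trivial.
    (* For [|z| = 1] the difference [|m z - n|^2 - m n |z - 1|^2] is exactly [(m - n)^2]. *)
    rewrite Cmod2_lattice, Hz.
    replace (Cmod w * Cmod w) with (Cmod w ^ 2) by ring. rewrite Hw2.
    assert (T := Rle_0_sqr (INR (S m) - INR (S n))). unfold Rsqr in T. lra. }
  specialize (D B (fun m n _ => B m n)).
  change (CSeries _) with N in D. rewrite HN in D.
  assert (Ef : Cmod (0 - lattice_term k z (-1) 0 0) = (/ Cmod w) ^ k).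
  { replace (0 - lattice_term k z (-1) 0 0)%C with (- lattice_term k z (-1) 0 0)%C by ring.
    rewrite Cmod_opp. unfold lattice_term. fold w.
    rewrite <- Cpow_inv, Cmod_pow, Cmod_inv; trivial; now apply Cmod_gt_0. }
  rewrite Ef in D. fold A in D.
  assert (Hp : 0 < (/ Cmod w) ^ k) by now apply pow_lt, Rinv_0_lt_compat.
  (* [D] now says that [t <= t (A^2 - 1)] with [t = |z - 1|^-k > 0], which would force
     [A^2 >= 2]. *)
  assert (A * A < 2) by nra. nra.
Qed.

(** * Zeros of large modulus *)

Lemma lattice_sum_acute_le (k : nat) (z : C) (e : R) :
  (4 <= k)%nat -> 1 <= Cmod z -> e * e = 1 -> 0 <= e * Re z ->
  Cmod (lattice_sum k z e)
  <= (/ sqrt (2 * Cmod z)) ^ k * (Series (hpow k) * Series (hpow k)).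
Proof.
  intros Hk Hz He Hx. assert (Hs := ex_series_hpow k Hk).
  set (c := (/ sqrt (2 * Cmod z)) ^ k).
  rewrite <- Rmult_assoc, <- (Series_scal_l c).
  apply double_series_le; trivial; [now apply (ex_series_scal (V := R_NormedModule))|].
  intros m n. rewrite Rmult_assoc. apply Cmod_inv_pow_sqrt_le; [apply sqrt_lt_R0; lra|].
  rewrite sqrt_sqrt, Cmod2_lattice by lra.
  assert (Pm := INR_S_pos m). assert (Pn := INR_S_pos n).
  set (p := INR (S m)) in *. set (q := INR (S n)) in *. set (r := Cmod z) in *.
  assert (0 < p * q) by now apply Rmult_lt_0_compat.
  replace (2 * Re z * (p * (e * q))) with (2 * (e * Re z) * (p * q)) by ring.
  replace (e * q * (e * q)) with (q * q) by (transitivity (e * e * (q * q)); [rewrite He|]; ring).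
  assert (0 <= (p * r - q) * (p * r - q)) by apply Rle_0_sqr. nra.
Qed.

(** The term of the nearest lattice point is estimated apart by [|z|^-k], at most [1/4] in the
    application. The general constant then multiplies only [A^2 - 1], which is small, rather than
    [A^2]. *)
Lemma lattice_sum_obtuse_le (k : nat) (z : C) (e : R) :
  (4 <= k)%nat -> 1 <= Cmod z -> - (1 / 2) <= Re z <= 1 / 2 -> e * e = 1 ->
  Cmod (lattice_sum k z e)
  <= (/ Cmod z) ^ k + (/ sqrt (2 * Cmod z - 1)) ^ k * (Series (hpow k) * Series (hpow k) - 1).
Proof.
  intros Hk Hz Hx He. assert (Hs := ex_series_hpow k Hk).
  set (c := (/ sqrt (2 * Cmod z - 1)) ^ k).
  assert (B : forall m n, Cmod (lattice_term k z e m n) <= c * (hpow k m * hpow k n))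
    by (intros; now apply lattice_term_le).
  assert (D := double_series_minus_first_le (lattice_term k z e) (hpow k) c c Hs (hpow_0 k)
    B (fun m n _ => B m n)).
  change (CSeries _) with (lattice_sum k z e) in D.
  set (f := lattice_term k z e 0 0) in *.
  (* [|z + e|^2 = |z|^2 + 2 e Re z + 1 >= |z|^2], because [|2 Re z| <= 1]. *)
  assert (F : Cmod f <= (/ Cmod z) ^ k).
  { apply Cmod_inv_pow_le_inv; [lra|].
    apply Rsqr_incr_0_var; [|apply Cmod_ge_0]. rewrite !Rsqr_pow2, Cmod2_lattice.
    change (INR 1) with 1.
    assert (- (1 / 2) <= e * Re z) by (assert (-1 <= e <= 1) by nra; nra). nra. }
  replace (lattice_sum k z e) with (f + (lattice_sum k z e - f))%C by ring.
  eapply Rle_trans; [apply Cmod_triangle|]. lra.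
Qed.

Lemma inv_pow_le_quarter (r : R) (k : nat) : 4 <= r ^ k -> (/ r) ^ k <= 1 / 4.
Proof.
  intros H. rewrite pow_inv. replace (1 / 4) with (/ 4) by field. apply Rinv_le_contravar; lra.
Qed.

Lemma zero_Cmod_pow_lt_4 (k : nat) (z : C) :
  Nat.Odd k -> (5 <= k)%nat -> 0 < Im z -> 1 <= Cmod z -> - (1 / 2) <= Re z <= 1 / 2 ->
  eisenstein k z = 0 -> Cmod z ^ k < 4.
Proof.
  intros Hodd Hk Hy Hz Hx HE. apply Rnot_le_lt. intros H4.
  assert (E := eisenstein_lattice k z ltac:(lia) Hy Hz Hx).
  rewrite HE, Cmult_0_r in E.
  destruct (zeta_ge_1 k ltac:(lia)) as [_ Hz1].
  set (P := lattice_sum k z 1) in *. set (N := lattice_sum k z (-1)) in *.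
  assert (Hr4 := inv_pow_le_quarter _ _ H4).
  (* The equation gives [zeta k (1 - |z|^-k) <= |P| + |N|], where [zeta k >= 1] and
     [|z|^-k <= 1/4]. *)
  assert (L : 3 / 4 <= Cmod P + Cmod N).
  { assert (E1 : RtoC (zeta k) = (- (zeta k * / z ^ k + (P + N)))%C).
    { transitivity (zeta k - 0)%C; [ring|]. rewrite E. ring. }
    apply (f_equal Cmod) in E1. rewrite Cmod_R, Rabs_pos_eq, Cmod_opp in E1 by lra.
    assert (T1 := Cmod_triangle (zeta k * / z ^ k) (P + N)).
    assert (T2 := Cmod_triangle P N).
    rewrite Cmod_mult, Cmod_R, Rabs_pos_eq in T1 by lra.
    assert (T3 : Cmod (/ z ^ k) <= (/ Cmod z) ^ k) by (apply Cmod_inv_pow_le_inv; lra).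
    nra. }
  set (A := Series (hpow k)).
  assert (HA1 := Series_hpow_ge_1 k ltac:(lia)). fold A in HA1.
  set (p := (/ sqrt (2 * Cmod z)) ^ k). set (s := (/ sqrt (2 * Cmod z - 1)) ^ k).
  assert (U : Cmod P + Cmod N <= 1 / 4 + s * (A * A - 1) + p * (A * A)).
  { destruct (Rle_dec 0 (Re z)) as [Hp|Hn].
    - assert (B1 := lattice_sum_acute_le k z 1 ltac:(lia) Hz ltac:(ring) ltac:(lra)).
      assert (B2 := lattice_sum_obtuse_le k z (-1) ltac:(lia) Hz Hx ltac:(ring)).
      fold P N A p s in B1, B2. lra.
    - assert (B1 := lattice_sum_acute_le k z (-1) ltac:(lia) Hz ltac:(ring) ltac:(lra)).
      assert (B2 := lattice_sum_obtuse_le k z 1 ltac:(lia) Hz Hx ltac:(ring)).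
      fold P N A p s in B1, B2. lra. }
  assert (Hinv : forall x c k0, 0 < c <= 1 -> 1 <= x * (c * c) -> (k0 <= k)%nat ->
     (/ sqrt x) ^ k <= c ^ k0).
  { intros x c k0 Hc Hxc Hk0. apply Rle_trans with (c ^ k); [|apply pow_le_pow; trivial; lra].
    apply pow_incr. split; [|now apply inv_sqrt_le].
    apply Rlt_le, Rinv_0_lt_compat, sqrt_lt_R0. nra. }
  (* From [k = 7] on, [|z| >= 1] suffices to bound [s] and [p]. For [k = 5] the true size of [|z|]
     is needed: [1319/1000] is just below [4^(1/5)]. *)
  destruct (Nat.eq_dec k 5) as [K5|K5].
  - assert (Hr : 1319 / 1000 <= Cmod z).
    { apply Rnot_lt_le. intros Hr. apply (Rlt_irrefl 4). eapply Rle_lt_trans; [exact H4|].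
      rewrite K5. apply Rle_lt_trans with ((1319 / 1000) ^ 5); [apply pow_incr; lra|lra]. }
    assert (HA := Series_hpow_le 5 k ltac:(lia) Hk). fold A in HA. simpl in HA.
    (* [0.616] and [0.782] lie just above the inverse square roots of [2 * 1.319] and
       [2 * 1.319 - 1]. The total is [0.25 + 0.276 + 0.1728 < 0.75]. *)
    assert (Hp := Hinv (2 * Cmod z) (616 / 1000) 5%nat ltac:(lra) ltac:(lra) Hk).
    assert (Hs := Hinv (2 * Cmod z - 1) (782 / 1000) 5%nat ltac:(lra) ltac:(lra) Hk).
    fold p in Hp. fold s in Hs. simpl in Hp, Hs.
    assert (HAA : A * A <= 192 / 100) by nra.
    assert (s * (A * A - 1) <= 3 / 10 * (92 / 100)) by
      (apply Rmult_le_compat; try nra;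
       apply pow_le, Rlt_le, Rinv_0_lt_compat, sqrt_lt_R0; lra).
    assert (p * (A * A) <= 9 / 100 * (192 / 100)) by
      (apply Rmult_le_compat; try nra;
       apply pow_le, Rlt_le, Rinv_0_lt_compat, sqrt_lt_R0; lra).
    lra.
  - assert (K7 : (7 <= k)%nat) by (destruct Hodd; lia).
    assert (HA := Series_hpow_le 7 k ltac:(lia) K7). fold A in HA. simpl in HA.
    (* Here [s <= 1], and the total is [0.25 + 0.32 + 0.1188 < 0.75]. *)
    assert (Hp := Hinv (2 * Cmod z) (7072 / 10000) 7%nat ltac:(lra) ltac:(lra) K7).
    assert (Hs := Hinv (2 * Cmod z - 1) 1 7%nat ltac:(lra) ltac:(lra) K7).
    fold p in Hp. fold s in Hs. simpl in Hp. rewrite pow1 in Hs.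
    assert (HAA : A * A <= 132 / 100) by nra.
    assert (s * (A * A - 1) <= 1 * (32 / 100)) by
      (apply Rmult_le_compat; try nra;
       apply pow_le, Rlt_le, Rinv_0_lt_compat, sqrt_lt_R0; lra).
    assert (p * (A * A) <= 9 / 100 * (132 / 100)) by
      (apply Rmult_le_compat; try nra;
       apply pow_le, Rlt_le, Rinv_0_lt_compat, sqrt_lt_R0; lra).
    lra.
Qed.

(** * Weight 3 *)

Lemma list_sum_le_const (l : list nat) (c : nat) :
  (forall x, In x l -> (x <= c)%nat) -> (list_sum l <= length l * c)%nat.
Proof.
  induction l as [|x l IH]; intros H; [apply le_n|].
  change (x + list_sum l <= c + length l * c)%nat.
  assert (H1 := H x (or_introl eq_refl)).
  assert (H2 := IH (fun y Hy => H y (or_intror Hy))). lia.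
Qed.

Lemma sigma_div_le (j n : nat) : (sigma_div j n <= n * n ^ j)%nat.
Proof.
  unfold sigma_div. eapply Nat.le_trans; [apply (list_sum_le_const _ (n ^ j))|].
  - intros x Hx. apply in_map_iff in Hx. destruct Hx as [d [<- Hd]].
    apply filter_In in Hd. destruct Hd as [Hd _]. apply in_seq in Hd.
    apply Nat.pow_le_mono_l. lia.
  - rewrite length_map. apply Nat.mul_le_mono_r.
    eapply Nat.le_trans; [apply filter_length_le|]. rewrite length_seq. lia.
Qed.

(** Consecutive cubes have ratio at most [8]. Together with [sigma_div_le] this bounds the q-series
    of weight 3 by a geometric series of ratio [8 |q|]. *)
Lemma cube_le_pow_8 (n : nat) : (S n * S n ^ 2 <= 8 ^ n)%nat.
Proof.
  induction n as [|n IH]; [simpl; lia|].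
  rewrite (Nat.pow_succ_r' 8 n). apply Nat.le_trans with (8 * (S n * S n ^ 2))%nat; [|lia].
  rewrite !Nat.pow_2_r. nia.
Qed.

(** Seven terms of the Leibniz series give an upper bound of about [3.284]. *)
Lemma PI_lt_3_3 : PI < 33 / 10.
Proof.
  destruct (PI_ineq 3) as [_ H]. simpl sum_f_R0 in H. unfold tg_alt, PI_tg in H. simpl in H. lra.
Qed.

Lemma one_plus_pow_le_exp (x : R) (n : nat) : 0 <= x -> (1 + x) ^ n <= exp (INR n * x).
Proof.
  intros Hx. induction n as [|n IH].
  - simpl. rewrite Rmult_0_l, exp_0. lra.
  - rewrite S_INR. replace ((INR n + 1) * x) with (x + INR n * x) by ring.
    rewrite exp_plus. apply Rmult_le_compat; trivial; [lra|apply pow_le; lra|apply exp_ineq1_le].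
Qed.

(** In the fundamental domain [|q| <= exp (- PI sqrt 3)], small enough to beat the coefficient,
    whose modulus is at most [(2 PI)^3 / 2]. In weight 3 the theorem therefore holds vacuously. *)
Lemma eisenstein_3_neq_0 (z : C) :
  0 < Im z -> 1 <= Cmod z -> - (1 / 2) <= Re z <= 1 / 2 -> eisenstein 3 z <> 0.
Proof.
  intros Hy Hz Hx HE. destruct (zeta_ge_1 3 ltac:(lia)) as [_ Hz1].
  assert (HPI := PI_lt_3_3). assert (HPI3 := PI2_3_2).
  (* [0.866] is just below [sqrt 3 / 2], the height of the corners of the domain. *)
  assert (Hy2 : 866 / 1000 <= Im z).
  { assert (M := Cmod2_alt z). assert (1 <= Cmod z ^ 2) by nra. nra. }
  set (p := Cmod (nome z)).
  assert (Hp : 0 <= p <= 1 / 156).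
  { split; [apply Cmod_ge_0|]. unfold p. rewrite Cmod_nome, exp_Ropp.
    replace (1 / 156) with (/ 156) by field. apply Rinv_le_contravar; [lra|].
    (* [2 PI Im z >= 6 * 0.866 > 5.19], and [exp 5.19 >= 1.0519^100 >= 1.658^10 >= 156]. *)
    apply Rle_trans with (exp (519 / 100)).
    - replace (519 / 100) with (INR 100 * (519 / 10000)) by (simpl; field).
      eapply Rle_trans; [|apply one_plus_pow_le_exp; lra].
      change 100%nat with (10 * 10)%nat. rewrite pow_mult.
      apply Rle_trans with ((1658 / 1000) ^ 10); [simpl; lra|].
      apply pow_incr. simpl. lra.
    - destruct (Rle_lt_or_eq_dec (519 / 100) (2 * PI * Im z)) as [L|L]; [nra| |].
      + now apply Rlt_le, exp_increasing.
      + apply Req_le. now f_equal. }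
  set (S3 := CSeries (fun n => INR (sigma_div (3 - 1) (S n)) * nome z ^ S n)%C).
  assert (HS : Cmod S3 <= p * / (1 - 8 * p)).
  { rewrite <- (is_series_unique _ _ (is_series_geom (8 * p) ltac:(rewrite Rabs_pos_eq; lra))).
    rewrite <- Series_scal_l. apply Cmod_CSeries_le.
    - intros n. rewrite Cmod_mult, Cmod_pow, Cmod_R, Rabs_pos_eq by apply pos_INR. fold p.
      replace (p * (8 * p) ^ n) with (INR (8 ^ n) * p ^ S n).
      + apply Rmult_le_compat_r; [apply pow_le; lra|]. apply le_INR.
        eapply Nat.le_trans; [apply sigma_div_le|apply cube_le_pow_8].
      + rewrite pow_INR, Rpow_mult_distr. replace (INR 8) with 8 by (simpl; ring). simpl. ring.
    - apply (ex_series_scal (V := R_NormedModule)), ex_series_geom. rewrite Rabs_pos_eq; lra. }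
  assert (HC : Cmod (eis_coef 3) <= (2 * (33 / 10)) ^ 3 / 2).
  { unfold eis_coef.
    assert (Hd : RtoC (zeta 3 * INR (fact (3 - 1))) <> 0).
    { intros E. apply RtoC_inj in E. simpl in E. lra. }
    rewrite <- (RtoC_mult (zeta 3)), Cmod_div, Cmod_pow, Cmod_opp, !Cmod_mult, !Cmod_R, Cmod_Ci by trivial.
    rewrite !Rabs_pos_eq by (simpl; lra). rewrite Rmult_1_r.
    apply Rmult_le_compat.
    - apply pow_le. lra.
    - apply Rlt_le, Rinv_0_lt_compat. simpl. lra.
    - apply pow_incr. lra.
    - apply Rinv_le_contravar; simpl; lra. }
  unfold eisenstein in HE. fold S3 in HE.
  assert (E1 : (eis_coef 3 * S3)%C = RtoC (-1)).
  { transitivity (1 + eis_coef 3 * S3 - 1)%C; [ring|]. rewrite HE.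
    rewrite <- RtoC_minus. f_equal. ring. }
  apply (f_equal Cmod) in E1. rewrite Cmod_mult, Cmod_R, Rabs_left in E1 by lra.
  (* [148 = 156 - 8]; the coefficient is at most [6.6^3 / 2 = 143.748], so the product stays below
     [1]. *)
  assert (HS2 : p * / (1 - 8 * p) <= 1 / 148).
  { apply (Rle_div_l p (1 / 148) (1 - 8 * p)); lra. }
  assert (B : Cmod (eis_coef 3) * Cmod S3 <= (2 * (33 / 10)) ^ 3 / 2 * (1 / 148)).
  { apply Rmult_le_compat; try apply Cmod_ge_0; lra. }
  lra.
Qed.

Theorem theorem1p2 :
  forall k : nat, Nat.Odd k -> (3 <= k)%nat ->
  forall z : cplx_cusp, fund_domain z -> eisenstein_cusp k z = RtoC 0 ->
    Rbar_lt (Finite 1) (Cmod_cusp z) /\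
    Rbar_lt (Cmod_cusp z) (Finite (Rpower 4 (1 / INR k))).
Proof.
  intros k Hodd Hk [z|] HF HE; simpl in HF, HE |- *.
  2:{ apply RtoC_inj in HE. lra. }
  destruct HF as [Hy [Hz Hx]].
  destruct (Nat.eq_dec k 3) as [->|K3].
  { now apply eisenstein_3_neq_0 in HE. }
  assert (K5 : (5 <= k)%nat) by (destruct Hodd; lia).
  split.
  - assert (H := zero_Cmod_neq_1 k z Hodd K5 Hy Hx HE). lra.
  - assert (H := zero_Cmod_pow_lt_4 k z Hodd K5 Hy Hz Hx HE).
    (* If [|z|] were at least [4^(1/k)], taking [k]-th powers would give [|z|^k >= 4]. *)
    apply Rnot_le_lt. intros Hr. apply (Rlt_not_le _ _ H).
    assert (Hk0 : INR k <> 0) by (apply not_0_INR; lia).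
    apply Rle_trans with (Rpower 4 (1 / INR k) ^ k).
    + rewrite <- Rpower_pow, Rpower_mult by apply exp_pos.
      replace (1 / INR k * INR k) with 1 by (field; trivial).
      rewrite Rpower_1; lra.
    + apply pow_incr. split; trivial. apply Rlt_le, exp_pos.
Qed.
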